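(* Let $p>0$ be arbitrary. There exists a constant $C>0$, depending on $\alpha,\beta,p$ (also through $\eta_2=\frac{\Gamma(1+\beta)}{\Gamma(1+\alpha+\beta)}$, $\eta_3=\frac{\Gamma(1+\alpha+2\beta)}{\Gamma(1+2\alpha+2\beta)}$) and on the fixed $l$ and $L$, but not on $f,h,g$, such that the following holds. Let $f\in L^2(\Omega)$ and let $g\in D\left(\exp\left(\frac{(-L)^r}{2}\right)\right)$ for some $r>0$, or $g\in D\left((-L)^{p/2}\right)$; let $h(y)=u(l,y)$ be the corresponding exact data. Then $$\|g\|_{L^2(\Omega)}\le C\left(\|g\|_{D((-L)^{p/2})}\right)^{\frac{2}{p+2}}\left(\|h\|_{L^2(\Omega)}+\|f\|_{L^2(\Omega)}\right)^{\frac{p}{p+2}}.$$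
   Context: Fix $\alpha\in(0,1]$, $\beta\ge 0$, $l>0$, and a bounded connected domain $\Omega\subset\mathbb{R}^N$ ($N\ge1$) with smooth boundary. $(\cdot,\cdot)$ is the inner product of $L^2(\Omega)$. $-L:H^2(\Omega)\cap H_0^1(\Omega)\to L^2(\Omega)$ is a fixed symmetric uniformly elliptic operator with eigenpairs $-L\varphi_k=\lambda_k\varphi_k$, $0<\lambda_1\le\lambda_2\le\cdots\to\infty$, where $\{\varphi_k\}_{k\ge1}$ is a complete orthonormal basis of $L^2(\Omega)$. For $s\in\mathbb{R}$, $D((-L)^s)=\{\psi\in L^2(\Omega):\sum_k\lambda_k^{2s}|(\psi,\varphi_k)|^2<\infty\}$ with norm $\|\psi\|_{D((-L)^s)}=(\sum_k\lambda_k^{2s}|(\psi,\varphi_k)|^2)^{1/2}$. For $r\in\mathbb{R}$, $D(\exp(\frac{(-L)^r}{2}))=\{\psi\in L^2(\Omega):\sum_k\exp(\lambda_k^r)|(\psi,\varphi_k)|^2<\infty\}$. Three-parameter Mittag-Leffler (Kilbas–Saigo) function, for $\alpha,m>0$, $n>-1/\alpha$: $E_{\alpha,m,n}(z)=1+\sum_{k=1}^\infty\prod_{j=0}^{k-1}\frac{\Gamma(\alpha(jm+n)+1)}{\Gamma(\alpha(jm+n+1)+1)}z^k$. The function $u$ is the solution of $\frac{1}{x^\beta}\partial_{0,x}^\alpha(\frac{1}{x^\beta}\partial_{0,x}^\alpha u)+Lu=g(y)$ in $(0,\infty)\times\Omega$ (Caputo derivatives in $x$), $u=0$ on $(0,\infty)\times\partial\Omega$,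 $u(0,\cdot)=f$, $u$ bounded in $L^2(\Omega)$ as $x\to\infty$, given by (with $f_k=(f,\varphi_k)$, $g_k=(g,\varphi_k)$) $$u(x,y)=\sum_{k=1}^{\infty} f_k\,E_{\alpha,1+\frac{\beta}{\alpha},\frac{\beta}{\alpha}}\left(-\sqrt{\lambda_k}\,x^{\alpha+\beta}\right)\varphi_k(y)-\sum_{k=1}^{\infty}\eta_2\frac{g_k}{\sqrt{\lambda_k}}\,x^{\alpha+\beta}E_{\alpha,1+\frac{\beta}{\alpha},1+\frac{2\beta}{\alpha}}\left(-\sqrt{\lambda_k}\,x^{\alpha+\beta}\right)\varphi_k(y).$$ *)

(* Defs.v *)
From HB Require Import structures.
From mathcomp Require Import all_boot all_order all_algebra.
From mathcomp Require Import all_classical all_reals all_analysis.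
Set Implicit Arguments.
Unset Strict Implicit.
Unset Printing Implicit Defensive.
Import Order.TTheory GRing.Theory Num.Theory.
Import numFieldNormedType.Exports.
Local Open Scope classical_set_scope.
Local Open Scope ring_scope.

Definition rV_display : measure_display. Proof. exact: (default_measure_display). Qed.

(* The sigma-algebra generated by the coordinates, i.e. the Borel sets; see
   [open_measurable_rV] below. *)
Section rV_measurable.
Context (R : realType) (n : nat).

Definition rV_coord (i : 'I_n) (x : 'rV[R]_n) : R := x ord0 i.

Let rV_measurable := g_sigma_preimage rV_coord.

Let rV_set0 : rV_measurable set0. Proof. exact: sigma_algebra0. Qed.
Let rV_setC A : rV_measurable A -> rV_measurable (~` A).
Proof. exact: sigma_algebraC. Qed.
Let rV_bigcup (F : (set _)^nat) : (forall i, rV_measurable (F i)) ->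
  rV_measurable (\bigcup_i F i).
Proof. exact: sigma_algebra_bigcup. Qed.

HB.instance Definition _ := @isMeasurable.Build rV_display
  'rV[R]_n rV_measurable rV_set0 rV_setC rV_bigcup.

Lemma measurable_rV_coord (i : 'I_n) : measurable_fun setT (rV_coord i).
Proof.
move=> _ Y mY; rewrite setTI; apply: sub_sigma_algebra => /=.
rewrite -bigcup_seq/=; exists i => /=; first by rewrite mem_index_enum.
by exists Y => //; rewrite setTI.
Qed.

Lemma measurable_rVP d (T : measurableType d) (f : T -> 'rV[R]_n) :
  (forall i, measurable_fun setT (rV_coord i \o f)) -> measurable_fun setT f.
Proof.
move=> mf.
have H : g_sigma_preimage (fun i => rV_coord i \o f) `<=` measurable.
  apply: smallest_sub; first exact: sigma_algebra_measurable.
  rewrite -bigcup_seq; apply: bigcup_sub => i _ A [B mB <-].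
  exact: mf.
move=> _ A mA; apply: H; rewrite g_sigma_preimage_comp.
by exists A.
Qed.

End rV_measurable.

Section lebesgue_cons.
Local Open Scope ereal_scope.
Context (R : realType) (n : nat).
Variable m : {sigma_finite_measure set 'rV[R]_n -> \bar R}.

Definition cons_rV (p : R * 'rV[R]_n) : 'rV[R]_n.+1 := row_mx p.1%:M p.2.

Lemma cons_rV0 p : cons_rV p ord0 ord0 = p.1.
Proof.
rewrite /cons_rV (_ : ord0 = lshift n (@ord0 0)); last exact/val_inj.
by rewrite (@row_mxEl _ 1 1 n) mxE.
Qed.

Lemma cons_rVS p i : cons_rV p ord0 (lift ord0 i) = p.2 ord0 i.
Proof.
rewrite /cons_rV (_ : lift ord0 i = rshift 1 i); last exact/val_inj.
exact: (@row_mxEr _ 1 1 n).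
Qed.

Lemma measurable_cons_rV : measurable_fun setT cons_rV.
Proof.
apply: measurable_rVP => i; have [j ->|->] := unliftP ord0 i.
  rewrite [X in measurable_fun _ X](_ : _ = rV_coord j \o snd).
    exact: measurableT_comp (measurable_rV_coord j) measurable_snd.
  by apply/funext => p; rewrite /= /rV_coord cons_rVS.
rewrite [X in measurable_fun _ X](_ : _ = fst); first exact: measurable_fst.
by apply/funext => p; rewrite /= /rV_coord cons_rV0.
Qed.

Definition lebesgue_cons := pushforward (@lebesgue_measure R \x m) cons_rV.

Let lebesgue_cons0 : lebesgue_cons set0 = 0.
Proof. by rewrite /lebesgue_cons /pushforward preimage_set0 measure0. Qed.

Let lebesgue_cons_ge0 A : 0 <= lebesgue_cons A.
Proof. by rewrite /lebesgue_cons /pushforward; exact: measure_ge0. Qed.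

Let lebesgue_cons_sigma_additive : semi_sigma_additive lebesgue_cons.
Proof.
move=> F mF tF mUF; rewrite /lebesgue_cons /pushforward preimage_bigcup.
apply: measure_semi_sigma_additive.
- by move=> k; rewrite -[X in measurable X]setTI; exact: measurable_cons_rV.
- apply/trivIsetP => /= i j _ _ ij; rewrite -preimage_setI.
  by move/trivIsetP : tF => /(_ _ _ _ _ ij) ->//; rewrite preimage_set0.
- by rewrite -preimage_bigcup -[X in measurable X]setTI;
    exact: measurable_cons_rV.
Qed.

HB.instance Definition _ := isMeasure.Build _ _ _ lebesgue_cons
  lebesgue_cons0 lebesgue_cons_ge0 lebesgue_cons_sigma_additive.

Let uncons (x : 'rV[R]_n.+1) : R * 'rV[R]_n :=
  (rV_coord ord0 x, \row_j rV_coord (lift ord0 j) x).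

Let unconsK : cancel cons_rV uncons.
Proof.
move=> [a x]; congr pair; first by rewrite /rV_coord cons_rV0.
by apply/rowP => j; rewrite mxE /rV_coord cons_rVS.
Qed.

Let measurable_uncons : measurable_fun setT uncons.
Proof.
apply/measurable_fun_pairP; split; first exact: measurable_rV_coord.
apply: measurable_rVP => i.
rewrite [X in measurable_fun _ X](_ : _ = rV_coord (lift ord0 i)); first exact: measurable_rV_coord.
by apply/funext => x /=; rewrite {1}/rV_coord mxE.
Qed.

Let lebesgue_cons_sigma_finite : sigma_finite setT lebesgue_cons.
Proof.
have /sigma_finiteP[F [FT ndF Foo]] := sigma_finiteT (@lebesgue_measure R).
have /sigma_finiteP[G [GT ndG Goo]] := sigma_finiteT m.
exists (fun k => uncons @^-1` (F k `*` G k)).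
  apply/esym; rewrite -subTset => x _.
  have [i _ Fi] : (\bigcup_k F k) (uncons x).1 by rewrite -FT.
  have [j _ Gj] : (\bigcup_k G k) (uncons x).2 by rewrite -GT.
  exists (maxn i j) => //; split.
    by move: Fi; exact/subsetPset/ndF/leq_maxl.
  by move: Gj; exact/subsetPset/ndG/leq_maxr.
move=> k; have [mF ?] := Foo k; have [mG ?] := Goo k; split.
  by rewrite -[X in measurable X]setTI; apply: measurable_uncons => //;
    exact: measurableX.
rewrite /lebesgue_cons /pushforward -comp_preimage.
rewrite (_ : uncons \o cons_rV = id); last exact/funext/unconsK.
by rewrite preimage_id product_measure1E// lte_mul_pinfty// ge0_fin_numE.
Qed.

HB.instance Definition _ := Measure_isSigmaFinite.Build _ _ _ lebesgue_cons
  lebesgue_cons_sigma_finite.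

End lebesgue_cons.

(* Lebesgue measure on R^n, characterized by [lebesgue_rV_box]. *)
Fixpoint lebesgue_rV (R : realType) (n : nat) :
    {sigma_finite_measure set 'rV[R]_n -> \bar R} :=
  if n is n'.+1 then lebesgue_cons (lebesgue_rV R n') else \d_(0 : 'rV[R]_0).

Lemma measurable_rV_box (R : realType) n (A : 'I_n -> set R) :
  (forall i, measurable (A i)) ->
  measurable [set x : 'rV[R]_n | forall i, A i (x ord0 i)].
Proof.
move=> mA.
rewrite (_ : [set _ | _] = \bigcap_(i in [set: 'I_n]) (@rV_coord R n i @^-1` A i)).
  apply: fin_bigcap_measurable => // i _.
  by rewrite -[X in measurable X]setTI; exact: measurable_rV_coord.
by apply/seteqP; split => x /= H i; [move=> _; exact: H|exact: (H i)].
Qed.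

Lemma lebesgue_rV_box (R : realType) n (A : 'I_n -> set R) :
  (forall i, measurable (A i)) ->
  lebesgue_rV R n [set x | forall i, A i (x ord0 i)] =
  (\prod_(i < n) lebesgue_measure (A i))%E.
Proof.
elim: n A => [|n IHn] A mA.
  by rewrite big_ord0 /= diracE mem_set//= => -[].
rewrite big_ord_recl -(IHn (A \o lift ord0)); last by move=> i; exact: mA.
have mB := measurable_rV_box (fun i => mA (lift ord0 i)).
rewrite -(product_measure1E lebesgue_measure _ (mA ord0) mB).
rewrite -[LHS]/((@lebesgue_measure R \x lebesgue_rV R n)%E
  (@cons_rV R n @^-1` [set x | forall i, A i (x ord0 i)])).
congr (_ _); apply/seteqP; split => -[a x] /=.
  move=> H; split => [|i] /=; first by have := H ord0; rewrite cons_rV0.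
  by have := H (lift ord0 i); rewrite cons_rVS.
move=> [/= Ha Hx] i; have [j ->|->] := unliftP ord0 i.
  by rewrite cons_rVS; exact: Hx.
by rewrite cons_rV0.
Qed.

Lemma open_measurable_rV (R : realType) n (U : set 'rV[R]_n) :
  open U -> measurable U.
Proof.
move=> oU.
pose B (q : 'rV[rat]_n * nat) : set 'rV[R]_n :=
  [set x | forall i, ball (ratr (q.1 ord0 i) : R) (q.2.+1%:R^-1) (x ord0 i)].
have mB q : measurable (B q).
  apply: (@measurable_rV_box _ _ (fun i => ball (ratr (q.1 ord0 i) : R) _)) => i.
  exact: measurable_realfun.measurable_ball.
pose G q := if `[< B q `<=` U >] then B q else set0.
have -> : U = \bigcup_q G q.
  apply/seteqP; split => [x Ux|x [q _]]; last first.
    by rewrite /G; case: asboolP => // + Bx; exact.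
  have : nbhs x U by move: oU; rewrite openE => /(_ _ Ux).
  move=> /nbhs_ballP[e /= e0 eU].
  have [k ke] : exists k : nat, k.+1%:R^-1 *+ 2 < e.
    have [k _ /(_ k (leqnn k)) H] := 
      near_infty_natSinv_lt (PosNum (divr_gt0 e0 (@ltr0Sn R 1))).
    by exists k; rewrite mulr2n [ltRHS]splitr ltrD.
  have Hq i : exists q : rat, ball (x ord0 i : R) (k.+1%:R^-1) (ratr q).
    have : x ord0 i - k.+1%:R^-1 < x ord0 i + k.+1%:R^-1.
      by rewrite ltrBlDr -addrA ltrDl addr_gt0// invr_gt0.
    move=> /rat_in_itvoo[q]; rewrite in_itv/= => /andP[q1 q2]; exists q.
    by rewrite /ball/= ltr_distlC q1.
  have [q qP] := choice Hq.
  exists (\row_i q i, k) => //; rewrite /G; case: asboolP => [_|[]] /=.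
    by move=> i; rewrite mxE; exact/ball_sym/qP.
  move=> y By; apply: eU; split => // a i; rewrite (ord1 a).
  apply: (@le_ball _ _ _ (k.+1%:R^-1 *+ 2)); first exact: ltW.
  rewrite mulr2n; apply: ball_triangle (qP i) _.
  by have := By i; rewrite mxE.
apply: countable_bigcupT_measurable; first exact: countableP.
by move=> q; rewrite /G; case: ifP.
Qed.

Section smooth_domains.
Context (R : realType) (n : nat).
Implicit Types (f : 'rV[R]_n -> R) (A : set 'rV[R]_n).

Definition partial (i : 'I_n) f : 'rV[R]_n -> R :=
  fun x => 'D_(delta_mx ord0 i) f x.

Fixpoint Ck (k : nat) f : Prop :=
  continuous f /\
  if k is k'.+1 then
    forall i, (forall x, derivable f x (delta_mx ord0 i)) /\ Ck k' (partial i f)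
  else True.

Definition smooth f : Prop := forall k, Ck k f.

(* Near each boundary point, [A] is the negativity set of a smooth function
   whose gradient does not vanish at that point, so that [A] lies locally on
   one side of its boundary, a smooth hypersurface. *)
Definition smooth_boundary A : Prop :=
  forall x, closure A x -> ~ A x ->
  exists U F, [/\ nbhs x U, smooth F, exists i, partial i F x != 0 &
    A `&` U = [set y | F y < 0] `&` U].

Record smooth_domain := SmoothDomain {
  domain_set :> set 'rV[R]_n;
  domain_open : open domain_set;
  domain_nonempty : domain_set !=set0;
  domain_bounded : bounded_set domain_set;
  domain_connected : connected domain_set;
  domain_smooth_boundary : smooth_boundary domain_set }.

End smooth_domains.

Arguments domain_open {R n}.

Section L2_spaces.
Context (R : realType) (n : nat) (Omega : smooth_domain R n).
Implicit Types (f g v w : 'rV[R]_n -> R).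

Definition domain_measure : {measure set 'rV[R]_n -> \bar R} :=
  mrestr (lebesgue_rV R n) (open_measurable_rV (domain_open Omega)).

(* Elements of L^2(Omega) are represented by Borel functions on the whole
   space; values outside Omega are irrelevant, [domain_measure] vanishing
   there. *)
Definition L2 : {pred 'rV[R]_n -> R} := Lfun domain_measure 2%:E.

Definition L2inner f g : R := \int[domain_measure]_x (f x * g x).

Definition L2norm f : R := fine ('N[domain_measure]_2%:E[EFin \o f])%E.

Definition L2_sum (s : nat -> 'rV[R]_n -> R) w : Prop :=
  w \in L2 /\
  (fun k : nat => L2norm (fun y => w y - \sum_(0 <= j < k) s j y)) @ \oo --> 0.

Definition test_function f : Prop :=
  smooth f /\
  exists K : set 'rV[R]_n,
    [/\ compact K, K `<=` Omega & forall x, ~ K x -> f x = 0].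

Definition is_weak_partial (i : 'I_n) v w : Prop :=
  forall f, test_function f -> L2inner v (partial i f) = - L2inner w f.

Definition weak_gradient v (Dv : 'I_n -> 'rV[R]_n -> R) : Prop :=
  forall i, Dv i \in L2 /\ is_weak_partial i v (Dv i).

Definition weak_hessian v (D2v : 'I_n -> 'I_n -> 'rV[R]_n -> R) : Prop :=
  exists2 Dv, weak_gradient v Dv & forall i, weak_gradient (Dv i) (D2v i).

Definition sobolev_H2 v : Prop := v \in L2 /\ exists D2v, weak_hessian v D2v.

(* H^1_0 is the closure of the test functions in the H^1 norm. *)
Definition sobolev_H10 v : Prop :=
  v \in L2 /\
  exists2 Dv, weak_gradient v Dv &
  exists f_ : nat -> 'rV[R]_n -> R,
    [/\ forall k, test_function (f_ k),
        (fun k => L2norm (v \- f_ k)) @ \oo --> 0 &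
        forall i, (fun k => L2norm (Dv i \- partial i (f_ k))) @ \oo --> 0].

Definition H2_H10 v : Prop := sobolev_H2 v /\ sobolev_H10 v.

(* [L] maps H^2 /\ H^1_0 to L^2, is symmetric for the L^2 inner product and acts
   as  sum_ij a_ij d_ij + sum_i b_i d_i + c  with bounded coefficients and a
   uniformly positive principal part; operators in divergence form with
   Lipschitz coefficients are of this kind.  [L] has the sign of the Laplacian,
   and its values off H^2 /\ H^1_0 are unconstrained. *)
Definition symmetric_uniformly_elliptic
    (L : ('rV[R]_n -> R) -> 'rV[R]_n -> R) : Prop :=
  [/\ forall v, H2_H10 v -> L v \in L2,
      forall v w, H2_H10 v -> H2_H10 w -> L2inner (L v) w = L2inner v (L w) &
      exists (a : 'I_n -> 'I_n -> 'rV[R]_n -> R)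
             (b : 'I_n -> 'rV[R]_n -> R) (c : 'rV[R]_n -> R) (theta M : R),
        [/\ [/\ forall i j, measurable_fun setT (a i j),
                forall i, measurable_fun setT (b i) &
                measurable_fun setT c],
            forall x, domain_set Omega x ->
              [/\ forall i j, `|a i j x| <= M,
                  forall i, `|b i x| <= M & `|c x| <= M],
            forall i j x, domain_set Omega x -> a i j x = a j i x,
            0 < theta /\ forall x (xi : 'rV[R]_n), domain_set Omega x ->
              theta * \sum_i xi ord0 i ^+ 2 <=
              \sum_i \sum_j a i j x * xi ord0 i * xi ord0 j &
            forall v Dv D2v, H2_H10 v ->
              weak_gradient v Dv -> (forall i, weak_gradient (Dv i) (D2v i)) ->
              {ae domain_measure, forall x,
                L v x = (\sum_i \sum_j a i j x * D2v i j x) +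
                        (\sum_i b i x * Dv i x) + c x * v x}]].

Section spectral.
Variables (lambda : nat -> R) (phi : nat -> 'rV[R]_n -> R).

(* Indices start at 0: [lambda k] and [phi k] are the (k+1)-st eigenpair. *)
Definition eigenbasis (L : ('rV[R]_n -> R) -> 'rV[R]_n -> R) : Prop :=
  [/\ [/\ 0 < lambda 0%N, nondecreasing_seq lambda &
          lambda k @[k --> \oo] --> +oo],
      forall k, H2_H10 (phi k) /\
        {ae domain_measure, forall x, - L (phi k) x = lambda k * phi k x},
      forall j k, L2inner (phi j) (phi k) = (j == k)%:R &
      forall psi, psi \in L2 ->
        L2_sum (fun k y => L2inner psi (phi k) * phi k y) psi].

Definition fractional_sum (s : R) psi : \bar R :=
  (\sum_(0 <= k <oo)
    (lambda k `^ (2 * s) * `|L2inner psi (phi k)| ^+ 2)%R%:E)%E.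

Definition fractional_domain (s : R) psi : Prop :=
  psi \in L2 /\ (fractional_sum s psi < +oo)%E.

Definition fractional_norm (s : R) psi : R :=
  Num.sqrt (fine (fractional_sum s psi)).

Definition exponential_domain (r : R) psi : Prop :=
  psi \in L2 /\
  (\sum_(0 <= k <oo)
    (expR (lambda k `^ r) * `|L2inner psi (phi k)| ^+ 2)%R%:E < +oo)%E.

End spectral.

End L2_spaces.

(* Meaningful for [0 < x]. *)
Definition Gamma (R : realType) (x : R) : R :=
  \int[lebesgue_measure]_(t in `]0, +oo[) (t `^ (x - 1) * expR (- t)).

Definition kilbas_saigo (R : realType) (alpha m n z : R) : R :=
  1 + limn (fun K : nat => \sum_(1 <= k < K)
    (\prod_(0 <= j < k)
       (Gamma (alpha * (j%:R * m + n) + 1) /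
        Gamma (alpha * (j%:R * m + n + 1) + 1))) * z ^+ k).

Definition eta2 (R : realType) (alpha beta : R) : R :=
  Gamma (1 + beta) / Gamma (1 + alpha + beta).

(* [u x] is the function u(x, .) given by the eigenfunction expansion, both
   series converging in L^2(Omega). *)
Definition exact_solution (R : realType) (n : nat) (Omega : smooth_domain R n)
    (lambda : nat -> R) (phi : nat -> 'rV[R]_n -> R) (alpha beta : R)
    (f g : 'rV[R]_n -> R) (u : R -> 'rV[R]_n -> R) : Prop :=
  forall x : R, 0 <= x ->
  exists u1 u2 : 'rV[R]_n -> R,
    [/\ L2_sum Omega (fun k y =>
          L2inner Omega f (phi k) *
          kilbas_saigo alpha (1 + beta / alpha) (beta / alpha)
            (- Num.sqrt (lambda k) * x `^ (alpha + beta)) * phi k y) u1,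
        L2_sum Omega (fun k y =>
          eta2 alpha beta * (L2inner Omega g (phi k) / Num.sqrt (lambda k)) *
          x `^ (alpha + beta) *
          kilbas_saigo alpha (1 + beta / alpha) (1 + 2 * beta / alpha)
            (- Num.sqrt (lambda k) * x `^ (alpha + beta)) * phi k y) u2 &
        u x = u1 \- u2].

(* Main.v *)
(* Write y(z) = E_{alpha, 1 + beta/alpha, beta/alpha}(-z) and z_k = sqrt(lambda_k)
   l^(alpha + beta).  The second Mittag-Leffler function satisfies
   eta_2 z E_{alpha, 1 + beta/alpha, 1 + 2 beta/alpha}(-z) = 1 - y(z), so that
   h_k = f_k y(z_k) - (g_k / lambda_k) (1 - y(z_k)).  Once 0 <= y <= y(z_0) < 1 on
   [z_0, oo) is known, |g_k| / lambda_k is bounded by a multiple of |f_k| + |h_k|,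
   and interpolating between this and the D((-L)^(p/2)) norm of g, by splitting
   the modes at a threshold, gives the estimate.

   The bounds on y come from its being a Laplace transform of a positive
   measure: the coefficients of y times k! form a moment sequence, because the
   Gauss product for Gamma writes them as limits of products of ratios of
   rising factorials (b)_k / (c)_k with b <= c, which are moments of beta laws.
   Log-convexity of Gamma controls the limit. *)

Require Import Defs.
From mathcomp Require Import all_boot all_order all_algebra.
From mathcomp Require Import all_classical all_reals all_analysis.
From mathcomp Require Import measurable_realfun ring lra.
Set Implicit Arguments.
Unset Strict Implicit.
Unset Printing Implicit Defensive.
Import Order.TTheory GRing.Theory Num.Theory.
Import numFieldNormedType.Exports.
Local Open Scope classical_set_scope.
Local Open Scope ring_scope.

(** * Moment sequences *)

Section moment_sequences.
Context {R : realType}.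
Implicit Types (t : nat -> R) (s : seq (R * R)).

(** For large [z] the terms of the alternating series [y(z)] are large and cancel, so neither its
    sign nor its monotonicity can be read off the coefficients. The positive measure supplies both,
    but it is never constructed. For each atom, [expR (- x)] lies above its Taylor sums with an even
    number of terms and below those with an odd number; each such comparison involves finitely many
    moments, so it passes to pointwise limits of finitely supported measures. Strictness,
    [y(z) < 1], comes from a single three-term sum near 0, and monotonicity carries it to all larger
    arguments. The Gauss product, cut after [n] factors, leaves Gamma quotients at points depending
    on the index [j]. Replacing them all by the one for [j = 0] leaves a pure power, again a moment
    sequence, and the error factors tend to 1. With [m = y(z_0)] the constant is
    [sqrt 2 * D ^ (p / (p + 2))], [D = sqrt 2 / (1 - m)]: one [sqrt 2] comes from the two halves of
    the spectral splitting, the other from separating [f] and [h]. *)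

Definition power_sum s (k : nat) : R := \sum_(w <- s) w.1 * w.2 ^+ k.

Definition nonneg_weights s := all (fun w : R * R => (0 <= w.1) && (0 <= w.2)) s.

(* These are the moment sequences [k |-> \int s ^ k dm(s)] of the measures [m] on
   the half-line, described without measures as pointwise limits of the moment
   sequences of finitely supported ones. *)
Definition moment_seq t : Prop := forall (K : nat) (e : R), 0 < e ->
  exists2 s, nonneg_weights s & forall k, (k <= K)%N -> `|t k - power_sum s k| < e.

Lemma moment_seq_lim (T : nat -> nat -> R) t :
  (forall n, moment_seq (T n)) -> (forall k, T n k @[n --> \oo] --> t k) ->
  moment_seq t.
Proof.
move=> mT Tt K e e0.
have e20 : 0 < e / 2 by rewrite divr_gt0.
have [n nP] : exists n, forall k, (k <= K)%N -> `|t k - T n k| < e / 2.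
  have [n _ nP] : \forall n \near \oo, forall k, (k <= K)%N -> `|t k - T n k| < e / 2.
    elim: K => [|K IH].
      have /cvgr_dist_lt/(_ _ e20) := Tt 0%N.
      by apply: filterS => n nP k; rewrite leqn0 => /eqP ->.
    have /cvgr_dist_lt/(_ _ e20) := Tt K.+1.
    apply: filterS2 IH => n nP nK k; rewrite leq_eqVlt => /predU1P[->//|].
    by rewrite ltnS => /nP.
  by exists n; apply: nP => /=.
have [s sP sT] := mT n K _ e20.
exists s => // k kK.
rewrite (_ : t k - _ = (t k - T n k) + (T n k - power_sum s k)); last by ring.
by rewrite (le_lt_trans (ler_normD _ _))// [ltRHS]splitr ltrD ?nP ?sT.
Qed.

(** The definition suits closure under limits; the sequential form suits sums, products and Taylor
    comparisons. Length [n] and tolerance [1 / (n + 1)] are taken together. *)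
Lemma moment_seqP t : moment_seq t <-> exists2 S : nat -> seq (R * R),
  forall n, nonneg_weights (S n) & forall k, power_sum (S n) k @[n --> \oo] --> t k.
Proof.
split=> [mt|[S S0 St]].
  have /choice[S SP] n : exists s, nonneg_weights s /\
      forall k, (k <= n)%N -> `|t k - power_sum s k| < n.+1%:R^-1.
    by have [|s s0 sP] := mt n n.+1%:R^-1; [rewrite invr_gt0|exists s].
  exists S => [n|k]; first by case: (SP n).
  apply/cvgrPdist_lt => e e0.
  near=> n; have [_ /(_ k)] := SP n.
  move=> /(_ _)/lt_trans; apply; first by near: n; exact: nbhs_infty_ge.
  by near: n; exact: (near_infty_natSinv_lt (PosNum e0)).
apply: (@moment_seq_lim (fun n => power_sum (S n))) => // n K e e0.
by exists (S n) => // k _; rewrite subrr normr0.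
Unshelve. all: by end_near. Qed.

Lemma moment_seq_power_sum s : nonneg_weights s -> moment_seq (power_sum s).
Proof. by move=> s0 K e e0; exists s => // k _; rewrite subrr normr0. Qed.

Lemma eq_moment_seq t t' : t =1 t' -> moment_seq t -> moment_seq t'.
Proof. by move=> /funext ->. Qed.

Lemma moment_seqD t t' : moment_seq t -> moment_seq t' ->
  moment_seq (fun k => t k + t' k).
Proof.
move=> /moment_seqP[S S0 St] /moment_seqP[S' S'0 S't].
apply: (@moment_seq_lim (fun n => power_sum (S n ++ S' n))) => [n|k].
  apply: moment_seq_power_sum; rewrite /nonneg_weights all_cat.
  by apply/andP; split; [exact: S0|exact: S'0].
under eq_fun do rewrite /power_sum big_cat/=.
by apply: cvgD; [exact: St|exact: S't].
Qed.

(** The moments of a product of independent variables are the products of their moments; [P n] is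
    the law of that product. *)
Lemma moment_seqM t t' : moment_seq t -> moment_seq t' ->
  moment_seq (fun k => t k * t' k).
Proof.
move=> /moment_seqP[S S0 St] /moment_seqP[S' S'0 S't].
pose P n := [seq (w.1 * w'.1, w.2 * w'.2) | w <- S n, w' <- S' n].
have PE n k : power_sum (P n) k = power_sum (S n) k * power_sum (S' n) k.
  rewrite /P /power_sum big_allpairs_dep mulr_suml; apply: eq_bigr => w _.
  by rewrite mulr_sumr; apply: eq_bigr => w' _ /=; rewrite exprMn mulrACA.
apply: (@moment_seq_lim (fun n => power_sum (P n))) => [n|k].
  apply: moment_seq_power_sum; apply/allP => _ /allpairsP[[w w'] /= [wS wS' ->]].
  have /allP/(_ _ wS)/andP[? ?] := S0 n; have /allP/(_ _ wS')/andP[? ?] := S'0 n.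
  by rewrite /= !mulr_ge0.
by under eq_fun do rewrite PE; exact: cvgM.
Qed.

Lemma moment_seqX (s : R) : 0 <= s -> moment_seq (fun k => s ^+ k).
Proof.
move=> s0; apply: (@eq_moment_seq (power_sum [:: (1, s)])) => [k|].
  by rewrite /power_sum big_seq1 mul1r.
by apply: moment_seq_power_sum; rewrite /nonneg_weights/= s0 ler01.
Qed.

Lemma moment_seq_cst (c : R) : 0 <= c -> moment_seq (fun=> c).
Proof.
move=> c0; apply: (@eq_moment_seq (power_sum [:: (c, 1)])) => [k|].
  by rewrite /power_sum big_seq1 expr1n mulr1.
by apply: moment_seq_power_sum; rewrite /nonneg_weights/= c0 ler01.
Qed.

Lemma moment_seq_sum n (T : nat -> nat -> R) : (forall j, moment_seq (T j)) ->
  moment_seq (fun k => \sum_(0 <= j < n) T j k).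
Proof.
move=> mT; elim: n => [|n IH].
  by apply: (eq_moment_seq _ (moment_seq_cst (lexx 0))) => k; rewrite big_geq.
by apply: (eq_moment_seq _ (moment_seqD IH (mT n))) => k; rewrite big_nat_recr.
Qed.

Lemma moment_seq_prod n (T : nat -> nat -> R) : (forall j, moment_seq (T j)) ->
  moment_seq (fun k => \prod_(0 <= j < n) T j k).
Proof.
move=> mT; elim: n => [|n IH].
  by apply: (eq_moment_seq _ (moment_seq_cst ler01)) => k; rewrite big_geq.
by apply: (eq_moment_seq _ (moment_seqM IH (mT n))) => k; rewrite big_nat_recr.
Qed.

(** Expanding the geometric series in [q * r ^+ k] exhibits the measure with mass [q ^+ j] at the
    point [r ^+ j]. *)
Lemma moment_seq_geometric (q r : R) : 0 <= q < 1 -> 0 <= r <= 1 ->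
  moment_seq (fun k => (1 - q * r ^+ k)^-1).
Proof.
move=> /andP[q0 q1] /andP[r0 r1].
apply: (@moment_seq_lim (fun J k => \sum_(0 <= j < J) (q * r ^+ k) ^+ j)) => [J|k].
  apply: moment_seq_sum => j.
  apply: (eq_moment_seq _
    (moment_seqM (moment_seq_cst (exprn_ge0 j q0)) (moment_seqX (exprn_ge0 j r0)))).
  by move=> k /=; rewrite exprMn -!exprM mulnC.
have := @cvg_geometric_series R 1 (q * r ^+ k); rewrite mul1r.
have -> : series (geometric 1 (q * r ^+ k)) =
    fun J => \sum_(0 <= j < J) (q * r ^+ k) ^+ j.
  by apply/funext => J; apply: eq_bigr => j _ /=; rewrite mul1r.
apply; rewrite ger0_norm ?mulr_ge0 ?exprn_ge0//.
by rewrite (le_lt_trans _ q1)// ler_piMr// exprn_ile1.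
Qed.

(* [b / (b + k)] is the limit of [be / (1 - (1 - be) (1 - e)^k)] as [e] tends to 0. *)
Lemma moment_seq_inv_shift (b : R) : 0 < b -> moment_seq (fun k => (b + k%:R)^-1).
Proof.
move=> b0.
(* Dividing by [b + 1] keeps both [b * e n] and [e n] at most 1 for every [n], as
   [moment_seq_geometric] requires. *)
pose e n : R := harmonic n / (b + 1).
have e0 : e n @[n --> \oo] --> (0 : R).
  by rewrite -[X in _ --> X](mul0r (b + 1)^-1); apply: cvgMl; exact: cvg_harmonic.
have b10 : 0 < b + 1 by rewrite addr_gt0.
have egt0 n : 0 < e n by rewrite /e divr_gt0 // /harmonic/= invr_gt0.
have ele1 n : e n <= (b + 1)^-1.
  by rewrite /e ler_piMl ?invr_ge0 ?(ltW b10)// /harmonic/= invf_le1 ?ler1n.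
have ebnd n : 0 < b * e n /\ b * e n <= 1 /\ e n <= 1.
  split; first by rewrite mulr_gt0.
  have H : (b + 1) * e n <= 1.
    by rewrite (le_trans (ler_wpM2l (ltW b10) (ele1 n)))// mulfV// gt_eqF.
  have := egt0 n; have : 0 < b * e n by rewrite mulr_gt0.
  by move: H; rewrite mulrDl mul1r; lra.
(* The denominator divided by [e n], written as a finite sum so that its limit is not of the form 0
   / 0. *)
pose d n k : R := b + \sum_(0 <= j < k) (1 - b * e n) * (1 - e n) ^+ j.
have dE n k : d n k * e n = 1 - (1 - b * e n) * (1 - e n) ^+ k.
  rewrite /d; elim: k => [|k IH]; first by rewrite big_geq//; ring.
  by rewrite big_nat_recr//= addrA mulrDl IH exprS; ring.
have dcvg k : d n k @[n --> \oo] --> b + k%:R.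
  elim: k => [|k IH].
    by rewrite /d; under eq_fun do rewrite big_geq//; exact: cvg_cst.
  rewrite /d; under eq_fun do rewrite big_nat_recr//= addrA.
  rewrite -[k.+1]addn1 natrD addrA; apply: cvgD; first exact: IH.
  rewrite -[X in _ --> X](_ : (1 - b * 0) * (1 - 0) ^+ k = 1); last first.
    by rewrite mulr0 subr0 expr1n mulr1.
  apply: cvgM.
    by apply: cvgB; [exact: cvg_cst|apply: cvgMr; exact: e0].
  elim: k {IH} => [|k IH].
    by rewrite expr0; under eq_fun do rewrite expr0; exact: cvg_cst.
  rewrite exprS; under eq_fun do rewrite exprS.
  by apply: cvgM => //; apply: cvgB; [exact: cvg_cst|exact: e0].
apply: (@moment_seq_lim (fun n k => e n * (1 - (1 - b * e n) * (1 - e n) ^+ k)^-1)).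
  move=> n; apply: moment_seqM; first exact/moment_seq_cst/ltW.
  have [? [? ?]] := ebnd n; have := egt0 n => ?.
  by apply: moment_seq_geometric; apply/andP; split; lra.
move=> k; rewrite (_ : (fun n => _) = fun n => (d n k)^-1); last first.
  apply/funext => n; rewrite -dE invfM mulrCA mulfV ?mulr1// gt_eqF//.
apply: cvgV; last exact: dcvg.
by rewrite gt_eqF// ltr_pwDl.
Qed.

Lemma moment_seq_shift_ratio (a b : R) : 0 < a -> a <= b ->
  moment_seq (fun k => (b + k%:R) / (a + k%:R)).
Proof.
move=> a0 ab.
have ba : 0 <= b - a by rewrite subr_ge0.
apply: (eq_moment_seq _ (moment_seqD (moment_seq_cst ler01)
  (moment_seqM (moment_seq_cst ba) (moment_seq_inv_shift a0)))) => k /=.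
have : a + k%:R != 0 by rewrite gt_eqF// ltr_pwDl.
by move=> ?; field.
Qed.

Definition rising (a : R) (k : nat) : R := \prod_(0 <= j < k) (a + j%:R).

Lemma rising_gt0 a k : 0 < a -> 0 < rising a k.
Proof. by move=> a0; apply: prodr_gt0 => j _; rewrite ltr_pwDl. Qed.

Lemma risingD a m k : rising a (m + k) = rising a m * rising (a + m%:R) k.
Proof.
rewrite /rising (@big_cat_nat _ _ _ m)//= ?leq_addr//; congr (_ * _).
rewrite -{1}(add0n m) (addnC m k) big_addn addnK.
by apply: eq_bigr => j _; rewrite natrD addrA addrAC.
Qed.

(* The ratio of rising factorials is the limit in [m] of the products over
   [i < m] of [(b + i + k) / (a + i + k)], normalised at [k = 0]. *)
Lemma moment_seq_rising_ratio (a b : R) : 0 < a -> a <= b ->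
  moment_seq (fun k => rising a k / rising b k).
Proof.
move=> a0 ab; have b0 : 0 < b by rewrite (lt_le_trans a0).
have pos c i : 0 < c -> 0 < c + i%:R :> R by move=> c0; rewrite ltr_pwDl.
pose T m k : R := \prod_(0 <= i < m)
  (((b + i%:R) + k%:R) / ((a + i%:R) + k%:R) * ((a + i%:R) / (b + i%:R))).
apply: (@moment_seq_lim T) => [m|k].
  apply: moment_seq_prod => j; apply: moment_seqM.
    by apply: moment_seq_shift_ratio; rewrite ?pos// lerD2r.
  by apply: moment_seq_cst; rewrite divr_ge0// ltW// pos.
(* Splitting a rising factorial of length [m + k] after [m] or after [k] factors trades the [m]
   factors involving [k] for [k] factors involving [m], each of which tends to 1. *)
have TE m : T m k = rising a k / rising b k *
    \prod_(0 <= j < k) ((b + m%:R + j%:R) / (a + m%:R + j%:R)).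
  rewrite /T big_split/= !prodf_div.
  have shift c : \prod_(0 <= i < m) (c + i%:R + k%:R) = rising (c + k%:R) m.
    by apply: eq_bigr => i _; rewrite addrAC.
  rewrite !shift -!/(rising _ _).
  have eq c : 0 < c -> rising (c + k%:R) m = rising c m * rising (c + m%:R) k / rising c k.
    move=> c0; apply/esym/(canLR (mulfK _)); first by rewrite gt_eqF// rising_gt0.
    by rewrite -risingD addnC risingD mulrC.
  rewrite !eq//.
  have n0 c i : 0 < c -> rising c i != 0 by move=> ?; rewrite gt_eqF// rising_gt0.
  by field; rewrite !n0 ?pos.
rewrite (funext TE : T^~ k = _) -[X in _ --> X]mulr1; apply: cvgMr.
elim: k {TE} => [|k IH].
  by rewrite [X in X @ _](_ : _ = cst 1);
    [exact: cvg_cst|apply/funext => m; rewrite big_geq].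
rewrite -[X in _ --> X]mulr1.
rewrite [X in X @ _](_ : _ = fun m => \prod_(0 <= j < k)
    ((b + m%:R + j%:R) / (a + m%:R + j%:R)) *
  ((b + m%:R + k%:R) / (a + m%:R + k%:R))); last first.
  by apply/funext => m; rewrite big_nat_recr.
apply: cvgM => //.
have H m : (b + m%:R + k%:R) / (a + m%:R + k%:R) = 1 + (b - a) * (a + m%:R + k%:R)^-1.
  have : a + m%:R + k%:R != 0 by rewrite gt_eqF// !pos.
  by move=> ?; field.
rewrite (funext H) -[X in _ --> X](addr0 1) -[X in _ --> _ + X](mulr0 (b - a)).
apply: cvgD; first exact: cvg_cst.
apply: cvgMr; apply/(@gtr0_cvgV0 _ _ _ _ (fun m : nat => a + m%:R + k%:R)).
  by near=> m; rewrite !pos.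
apply: (@ger_cvgy _ _ _ _ (fun m : nat => m%:R)); last exact: cvgr_idn.
by near=> m; rewrite addrAC lerDr addr_ge0// ltW.
Unshelve. all: by end_near. Qed.

End moment_sequences.

(** * Power series of moment sequences *)

Section alternating_sums.
Context {R : realType}.
Implicit Types (t : nat -> R) (x z : R).

(* Partial sums of [\int expR (- x * s) dm(s)], where [t] is the moment sequence
   of [m]. *)
Definition alt_sum t x (n : nat) : R := \sum_(0 <= k < n) t k * (- x) ^+ k / k`!%:R.

(** The coefficient 1 is the constant sequence fed to [alt_sum]: the moments of the unit mass at 1,
    whose sums are the Taylor sums of [expR (- x)]. *)
Let is_derive_term m (y : R) :
  is_derive y 1 (fun z : R => 1 * (- z) ^+ m.+1 / m.+1`!%:R) (- (1 * (- y) ^+ m / m`!%:R)).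
Proof.
have : is_derive y 1 ((m.+1`!%:R)^-1 \*: ((- (@id R)) ^+ m.+1))
    ((m.+1`!%:R)^-1 *: ((m.+1%:R * (- (@id R)) y ^+ m) *: (- 1))).
  by apply: is_deriveZ; apply: is_deriveX; apply: is_deriveN; exact: is_derive_id.
rewrite [X in is_derive _ _ X _ -> _](_ : _ =
    fun z : R => 1 * (- z) ^+ m.+1 / m.+1`!%:R); last first.
  by apply/funext => z; rewrite mul1r mulrC /=; congr (_ * _); rewrite exprfctE.
move=> H; apply: (is_derive_eq H); rewrite factS natrM.
rewrite [LHS](_ : _ = (m.+1%:R * m`!%:R)^-1 * ((m.+1%:R * (- y) ^+ m) * -1))//.
have : m`!%:R != 0 :> R by rewrite pnatr_eq0 -lt0n fact_gt0.
have : m.+1%:R != 0 :> R by rewrite pnatr_eq0.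
by move: (m.+1%:R : R) (m`!%:R : R) => u v u0 v0; field; rewrite u0 v0.
Qed.

Let is_derive_alt_sum m (y : R) :
  is_derive y 1 (fun z => alt_sum (fun=> 1) z m.+1) (- alt_sum (fun=> 1) y m).
Proof.
elim: m => [|m IH].
  rewrite /alt_sum big_geq// oppr0.
  rewrite (_ : (fun=> _) = cst 1); first exact: is_derive_cst.
  by apply/funext => z; rewrite big_nat1 expr0 fact0 divr1 mulr1.
rewrite (_ : (fun=> _) = (fun z => alt_sum (fun=> 1) z m.+1) +
    (fun z => 1 * (- z) ^+ m.+1 / m.+1`!%:R)); last first.
  by apply/funext => z; rewrite /alt_sum [LHS]big_nat_recr.
have -> : - alt_sum (fun=> 1) y m.+1 = - alt_sum (fun=> 1) y m + - (1 * (- y) ^+ m / m`!%:R).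
  by rewrite -opprD /alt_sum big_nat_recr.
by apply: is_deriveD.
Qed.

(** The signed remainder vanishes at 0 and its derivative is the preceding signed remainder, so
    induction and the mean value theorem apply. *)
Lemma expRN_alt_sum n x : 0 <= x ->
  0 <= (-1) ^+ n * (expR (- x) - alt_sum (fun=> 1) x n).
Proof.
elim: n x => [|n IH] x x0.
  by rewrite expr0 mul1r /alt_sum big_geq// subr0 expR_ge0.
pose F := (-1) ^+ n.+1 \*: ((expR \o (- (@id R))) - (fun y => alt_sum (fun=> 1) y n.+1)).
have dF (y : R) : is_derive y 1 F ((-1) ^+ n * (expR (- y) - alt_sum (fun=> 1) y n)).
  have H : is_derive y 1 F ((-1) ^+ n.+1 *: (expR ((- (@id R)) y) * -1
      - (- alt_sum (fun=> 1) y n))).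
    have dN : is_derive y 1 (- (@id R)) (-1) by apply: is_deriveN; exact: is_derive_id.
    by apply: is_deriveZ; apply: is_deriveB.
  apply: (is_derive_eq H); rewrite -[_ *: _]/(_ * _) -[(- id) y]/(- y) exprS; ring.
have cF : {within `[0, x], continuous F}.
  apply: continuous_subspaceT => y; apply: differentiable_continuous.
  by apply/derivable1_diffP; have := dF y; case.
have [c] := MVT_segment x0 (fun y _ => dF y) cF.
rewrite in_itv/= => /andP[c0 _] H.
have F0 : F 0 = 0.
  rewrite [LHS](_ : _ = (-1) ^+ n.+1 * (expR (- 0) - alt_sum (fun=> 1) 0 n.+1))//.
  rewrite oppr0 expR0 /alt_sum big_nat_recl//= expr0 big1 ?addr0.
    by rewrite fact0 divr1 mulr1 subrr mulr0.
  by move=> i _; rewrite oppr0 expr0n/= mulr0 mul0r.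
have -> : (-1) ^+ n.+1 * (expR (- x) - alt_sum (fun=> 1) x n.+1) = F x - F 0.
  by rewrite F0 subr0.
by rewrite H subr0 mulr_ge0// IH.
Qed.

Lemma alt_sum_power_sum s x n :
  alt_sum (power_sum s) x n = \sum_(w <- s) w.1 * alt_sum (fun=> 1) (x * w.2) n.
Proof.
under [RHS]eq_bigr do rewrite mulr_sumr.
rewrite exchange_big/=; apply: eq_bigr => k _.
rewrite /power_sum mulr_suml mulr_suml; apply: eq_bigr => w _.
by rewrite mul1r -mulNr exprMn; ring.
Qed.

Let laplace (s : seq (R * R)) x := \sum_(w <- s) w.1 * expR (- (x * w.2)).

Let laplace_alt_sum s x n : nonneg_weights s -> 0 <= x ->
  0 <= (-1) ^+ n * (laplace s x - alt_sum (power_sum s) x n).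
Proof.
move=> /allP s0 x0; rewrite alt_sum_power_sum -sumrB mulr_sumr big_seq.
apply: sumr_ge0 => w /s0/andP[w1 w2].
by rewrite -mulrBr mulrCA mulr_ge0// expRN_alt_sum// mulr_ge0.
Qed.

Let cvg_alt_sum (S : nat -> seq (R * R)) t x n :
  (forall k, power_sum (S m) k @[m --> \oo] --> t k) ->
  alt_sum (power_sum (S m)) x n @[m --> \oo] --> alt_sum t x n.
Proof.
move=> St; elim: n => [|n IH].
  rewrite /alt_sum big_geq// [X in X @ _](_ : _ = cst 0); first exact: cvg_cst.
  by apply/funext => m; rewrite big_geq.
rewrite [X in X @ _](_ : _ = (fun m => alt_sum (power_sum (S m)) x n +
    power_sum (S m) n * ((- x) ^+ n / n`!%:R))); last first.
  by apply/funext => m; rewrite /alt_sum big_nat_recr//= mulrA.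
rewrite /alt_sum big_nat_recr//= -mulrA.
by apply: cvgD => //; apply: cvgMl; exact: St.
Qed.

(* Every sum [\sum_w w.1 * expR (- x * w.2)] lies between its even and odd
   Taylor sums, and these involve finitely many terms, so that the comparison
   survives pointwise limits of the power sums. *)
Lemma moment_seq_alt_sum t x z m n : moment_seq t -> 0 <= x <= z ->
  alt_sum t z m.*2 <= alt_sum t x n.*2.+1.
Proof.
move=> /moment_seqP[S S0 St] /andP[x0 xz].
have cz := @cvg_alt_sum S t z m.*2 St; have cx := @cvg_alt_sum S t x n.*2.+1 St.
apply: (ler_cvg_to cz cx).
near=> k.
have := laplace_alt_sum n.*2.+1 (S0 k) x0.
have := laplace_alt_sum m.*2 (S0 k) (le_trans x0 xz).
have em : (-1) ^+ m.*2 = 1 :> R by rewrite -signr_odd odd_double.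
have en : (-1) ^+ n.*2.+1 = -1 :> R by rewrite -signr_odd /= odd_double.
rewrite em en mul1r mulN1r opprB !subr_ge0.
move=> Hm Hn; apply: le_trans Hm (le_trans _ Hn).
rewrite /laplace big_seq [leRHS]big_seq; apply: ler_sum => w wS.
have /allP/(_ _ wS)/andP[w1 w2] := S0 k.
by rewrite ler_wpM2l// ler_expR lerN2 ler_wpM2r.
Unshelve. all: by end_near. Qed.

Lemma moment_seq_alt_sum_ge0 t x n : moment_seq t -> 0 <= x ->
  0 <= alt_sum t x n.*2.+1.
Proof.
by move=> mt x0; have := @moment_seq_alt_sum t x x 0 n mt;
  rewrite /alt_sum big_geq//; apply; rewrite x0 lexx.
Qed.

End alternating_sums.

(** * The Gamma function *)

Section powers_and_exponential.
Context {R : realType}.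
Implicit Types (a t : R).

(** Only half of the exponent is spent on the power, so that [t ^ a * expR (- t)] is still dominated
    by the integrable [C * expR (- (t / 2))]. *)
Lemma powR_le_expR_half a : 0 <= a ->
  exists2 C, 0 < C & forall t, 0 <= t -> t `^ a <= C * expR (t / 2).
Proof.
move=> a0; pose N := Num.bound a.
have aN : a < N%:R by exact: archi_boundP.
have C0 : 0 < 2 ^+ N.+1 * N.+1`!%:R :> R by rewrite mulr_gt0 ?exprn_gt0 ?ltr0n ?fact_gt0.
(* The summand 1 handles [t <= 1]; the other comes from the Taylor term of degree [N.+1] at [t / 2]
   and handles [t >= 1]. *)
exists (1 + 2 ^+ N.+1 * N.+1`!%:R) => [|t t0]; first by rewrite addr_gt0.
have t20 : 0 <= t / 2 by rewrite divr_ge0.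
have e1 : 1 <= expR (t / 2) by rewrite -[leLHS]expR0 ler_expR.
have [t1|/ltW t1] := leP t 1.
  rewrite (@le_trans _ _ 1)//.
    by have := @ge0_ler_powR R a a0 t 1; rewrite powR1 !nnegrE; apply.
  by rewrite (le_trans e1)// ler_peMl ?expR_ge0// lerDl ltW.
have -> : t `^ a <= (1 + 2 ^+ N.+1 * N.+1`!%:R) * expR (t / 2) =
   (t `^ a <= expR (t / 2) + (2 ^+ N.+1 * N.+1`!%:R) * expR (t / 2)).
  by rewrite mulrDl mul1r.
rewrite (@le_trans _ _ (t ^+ N.+1))//.
  by rewrite -powR_mulrn// ler_powR// (le_trans (ltW aN))// ler_nat.
have := expR_ge1Dxn N t20; rewrite exprMn exprVn => H.
rewrite (@le_trans _ _ (2 ^+ N.+1 * N.+1`!%:R * expR (t / 2)))//; last first.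
  by rewrite lerDr expR_ge0.
rewrite -ler_pdivrMl// (le_trans _ H)//.
rewrite [leLHS](_ : _ = t ^+ N.+1 * (2 ^+ N.+1)^-1 / N.+1`!%:R) ?lerDr//.
by rewrite invfM mulrC mulrA.
Qed.

(** Young's inequality for [u / A] and [v / B]. When [A] and [B] are the integrals of [u] and [v],
    the right-hand side integrates to [A ^ s * B ^ (1 - s)], which is how Hölder's inequality is
    obtained for Gamma. *)
Lemma weighted_amgm (A B u v s : R) : 0 < A -> 0 < B -> 0 <= u -> 0 <= v -> 0 < s < 1 ->
  u `^ s * v `^ (1 - s) <=
  A `^ s * B `^ (1 - s) * s / A * u + A `^ s * B `^ (1 - s) * (1 - s) / B * v.
Proof.
move=> A0 B0 u0 v0 /andP[s0 s1].
have s'0 : 0 < 1 - s by rewrite subr_gt0.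
have AB0 : 0 < A `^ s * B `^ (1 - s) by rewrite mulr_gt0// powR_gt0.
have uA : 0 <= u / A by rewrite divr_ge0// ltW.
have vB : 0 <= v / B by rewrite divr_ge0// ltW.
have sV0 : 0 < s^-1 by rewrite invr_gt0.
have s'V0 : 0 < (1 - s)^-1 by rewrite invr_gt0.
have ss' : s^-1^-1 + (1 - s)^-1^-1 = 1 by rewrite !invrK addrC subrK.
have := conjugate_powR (powR_ge0 (u / A) s) (powR_ge0 (v / B) (1 - s)) sV0 s'V0 ss'.
rewrite -(powRrM (u / A)) -(powRrM (v / B)) !mulfV ?gt_eqF// !powRr1// !invrK.
rewrite -(ler_pM2l AB0) powRM ?invr_ge0 ?(ltW A0)// powRM ?invr_ge0 ?(ltW B0)//.
rewrite -(powR_inv1 (ltW A0)) -(powR_inv1 (ltW B0)) -(powRrM A) -(powRrM B) !mulN1r !powRN.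
rewrite !powRr1 ?(ltW A0) ?(ltW B0)//.
set a := A `^ s; set b := B `^ (1 - s).
have a0 : a != 0 by rewrite gt_eqF// powR_gt0.
have b0 : b != 0 by rewrite gt_eqF// powR_gt0.
rewrite [leLHS](_ : _ = u `^ s * v `^ (1 - s)); last by field; rewrite a0 b0.
by move=> /le_trans; apply; rewrite le_eqVlt; apply/orP; left; apply/eqP; ring.
Qed.

Lemma powR_cvg_at_right0 a : 0 < a -> t `^ a @[t --> 0^'+] --> (0 : R).
Proof.
move=> a0; apply/cvgrPdist_lt => e e0; near=> t.
have t0 : 0 < t by [].
rewrite sub0r normrN ger0_norm ?powR_ge0//.
have -> : e = (e `^ a^-1) `^ a by rewrite -powRrM mulVf ?gt_eqF// powRr1// ltW.
rewrite gt0_ltr_powR ?nnegrE ?powR_ge0 ?(ltW t0)//.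
by near: t; apply: nbhs_right_lt; rewrite powR_gt0.
Unshelve. all: by end_near. Qed.

Lemma expRN_half_cvgy : expR (- (t / 2)) @[t --> +oo] --> (0 : R).
Proof.
apply/cvgrPdist_lt => e e0.
have /cvgrPdist_lt/(_ _ e0)[M [Mr HM]] := @cvgr_expR R.
exists (2 * M); split; first by rewrite num_real.
by move=> t; rewrite -ltr_pdivlMl// mulrC => /HM.
Qed.

End powers_and_exponential.

(** * Recurrence, positivity and logarithmic convexity of Gamma from 1 on *)

Section gamma.
Context {R : realType}.
Implicit Types (a t x y : R).
Local Notation mu := (@lebesgue_measure R).
Local Notation posl := (`]0, +oo[%classic : set R).

Let gint a t : R := t `^ a * expR (- t).

Let gint_ge0 a t : 0 <= gint a t.
Proof. by rewrite mulr_ge0 ?powR_ge0 ?expR_ge0. Qed.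

Let measurable_gint a D : measurable_fun D (gint a).
Proof.
apply: measurable_funTS; apply: measurable_funM.
  exact: measurable_powR.
by apply: measurableT_comp => //; exact: measurable_expR.
Qed.

Let is_derive_gint a t : 0 < t ->
  is_derive t 1 (gint (a + 1)) ((a + 1) * gint a t - gint (a + 1) t).
Proof.
move=> t0.
have d1 := is_derive1_powR (a + 1) t0.
have d2 : is_derive t 1 (fun t : R => expR (- t)) (- expR (- t)).
  have dN : is_derive t 1 (- (@id R)) (-1) by apply: is_deriveN; exact: is_derive_id.
  by apply: (is_derive_eq (is_derive1_comp (is_derive_expR _) dN)); rewrite mulrN1.
apply: (is_derive_eq (is_deriveM d1 d2)).
by rewrite addrK -![_ *: _]/(_ * _) /gint; ring.
Qed.

Let is_derive_expRN_half t :
  is_derive t 1 (fun t : R => expR (- (t / 2))) (- (expR (- (t / 2)) / 2)).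
Proof.
have dN : is_derive t 1 (2^-1 \*: - (@id R)) (2^-1 *: -1).
  by apply: is_deriveZ; apply: is_deriveN; exact: is_derive_id.
have H := is_derive1_comp (is_derive_expR _) dN.
rewrite [X in is_derive _ _ X _ ](_ : _ = expR \o (2^-1 \*: - (@id R))).
  apply: (is_derive_eq H).
  rewrite [LHS](_ : _ = expR (2^-1 * - t) * (2^-1 * -1))//.
  by rewrite (_ : 2^-1 * - t = - (t / 2)); ring.
apply/funext => z; rewrite [RHS](_ : _ = expR (2^-1 * - z))//.
by congr (expR _); ring.
Qed.

Let continuous_is_derive (f : R -> R) df t : is_derive t 1 f df -> {for t, continuous f}.
Proof. by case=> d _; apply: differentiable_continuous; apply/derivable1_diffP. Qed.

Let integral_posl (f : R -> \bar R) : measurable_fun posl f ->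
  (\int[mu]_(t in `[0%R, +oo[) f t = \int[mu]_(t in posl) f t)%E.
Proof. by move=> mf; rewrite integral_itv_obnd_cbnd. Qed.

Let integral_expRN_half : (\int[mu]_(t in posl) (expR (- (t / 2)))%:E = 2%:E)%E.
Proof.
have mE : measurable_fun posl (fun t : R => expR (- (t / 2))).
  apply: measurable_funTS; apply: measurableT_comp; first exact: measurable_expR.
  by apply: measurableT_comp => //; exact: measurable_funM.
rewrite -integral_posl; last exact/measurable_EFinP.
pose F : R -> R := -2 \*: (fun t : R => expR (- (t / 2))).
have dF t : is_derive t 1 F (expR (- (t / 2))).
  apply: (is_derive_eq (is_deriveZ _ (is_derive_expRN_half t))).
  by rewrite -[LHS]/(_ * _); field.
rewrite (@ge0_continuous_FTC2y _ _ F _ 0).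
- rewrite /F /= -[_ *: _]/(_ * _) mul0r oppr0 expR0.
  by rewrite -EFinB; congr EFin; ring.
- by move=> t _; exact: expR_ge0.
- apply: continuous_subspaceT => t; exact: continuous_is_derive (is_derive_expRN_half t).
- rewrite -[X in _ --> X](scaler0 _ (-2 : R)); apply: cvgZr; exact: expRN_half_cvgy.
- by move=> t _; case: (dF t).
- by apply: cvg_at_right_filter; exact: continuous_is_derive (dF 0).
- by move=> t _; rewrite derive1E; case: (dF t).
Qed.

Let cvg_gint0 a : 0 <= a -> gint a t @[t --> 0^'+] --> gint a 0.
Proof.
move=> a0; apply: cvgM; last first.
  apply: cvg_at_right_filter.
  by apply: continuous_comp; [exact: opp_continuous|exact: continuous_expR].
have [->|an0] := eqVneq a 0.
  by rewrite powRr0 [X in X @ _](_ : _ = cst 1) ?powRr0;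
    [exact: cvg_cst|apply/funext => t; rewrite powRr0].
by rewrite powR0//; apply: powR_cvg_at_right0; rewrite lt_neqAle eq_sym an0.
Qed.

Let cvg_ginty a : 0 <= a -> gint a t @[t --> +oo] --> (0 : R).
Proof.
move=> a0; have [C C0 HC] := powR_le_expR_half a0.
apply: (@squeeze_cvgr _ _ _ _ (cst 0) (fun t : R => C * expR (- (t / 2)))).
- near=> t; rewrite gint_ge0/= /gint.
  have t0 : 0 <= t by [].
  rewrite (le_trans (ler_wpM2r (expR_ge0 _) (HC _ t0)))//.
  by rewrite -mulrA -expRD ler_pM2l// ler_expR; lra.
- exact: cvg_cst.
- rewrite -[X in _ --> X](mulr0 C); apply: cvgMr; exact: expRN_half_cvgy.
Unshelve. all: by end_near. Qed.

(* The exponential term makes the integrand nonnegative, as the fundamental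
   theorem of calculus on a half-line requires. *)
Let integral_gint_aux a C : 0 <= a -> 0 < C ->
  (forall t, 0 <= t -> (a + 1) * t `^ a <= C * expR (t / 2)) ->
  (\int[mu]_(t in posl)
    ((C * expR (- (t / 2)) - (a + 1) * gint a t) + gint (a + 1) t)%:E = (2 * C)%:E)%E.
Proof.
move=> a0 C0 HC.
have a1 : 0 < a + 1 by rewrite ltr_wpDl.
have a10 := ltW a1.
set f := fun t : R => (C * expR (- (t / 2)) - (a + 1) * gint a t) + gint (a + 1) t.
have mE D : measurable_fun D (fun t : R => expR (- (t / 2))).
  apply: measurable_funTS; apply: measurableT_comp; first exact: measurable_expR.
  by apply: measurableT_comp => //; exact: measurable_funM.
have mf : measurable_fun posl f.
  apply: measurable_funD => //; apply: measurable_funB; first exact: measurable_funM.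
  exact: measurable_funM.
rewrite -integral_posl; last exact/measurable_EFinP.
pose F : R -> R := (- (2 * C)) \*: (fun t : R => expR (- (t / 2))) - gint (a + 1).
have dF t : 0 < t -> is_derive t 1 F (f t).
  move=> t0; have dg := is_derive_gint a t0; have de := is_derive_expRN_half t.
  have H : is_derive t 1 F
      (- (2 * C) *: - (expR (- (t / 2)) / 2) - ((a + 1) * gint a t - gint (a + 1) t)).
    by apply: is_deriveB; apply: is_deriveZ.
  by apply: (is_derive_eq H); rewrite -[_ *: _]/(_ * _) /f; field.
have F0 : F t @[t --> 0^'+] --> F 0.
  apply: cvgB; last exact: cvg_gint0.
  apply: cvgZr; apply: cvg_at_right_filter.
  exact: continuous_is_derive (is_derive_expRN_half 0).
have cf0 : f t @[t --> 0^'+] --> f 0.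
  apply: cvgD; last exact: cvg_gint0.
  apply: cvgB; last by apply: cvgMr; exact: cvg_gint0.
  apply: cvgMr; apply: cvg_at_right_filter.
  exact: continuous_is_derive (is_derive_expRN_half 0).
rewrite (@ge0_continuous_FTC2y _ _ F _ 0).
- rewrite [F 0](_ : _ = - (2 * C) * expR (- (0 / 2)) - gint (a + 1) 0)//.
  rewrite /gint powR0 ?gt_eqF// mul0r oppr0 expR0 mul0r.
  by rewrite -EFinB; congr EFin; ring.
- move=> t t0; rewrite /f addr_ge0// subr_ge0 /gint mulrA.
  rewrite (le_trans (ler_wpM2r (expR_ge0 _) (HC _ t0)))//.
  by rewrite -mulrA -expRD ler_pM2l// ler_expR; lra.
- apply/continuous_within_itvcyP; split => // t; rewrite in_itv/= andbT => t0.
  have cg b : 0 <= b -> {for t, continuous (gint b)}.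
    move=> b0; apply: cvgM; last first.
      by apply: continuous_comp; [exact: opp_continuous|exact: continuous_expR].
    exact: continuous_is_derive (is_derive1_powR b t0).
  apply: cvgD; last exact: cg.
  apply: cvgB; last by apply: cvgMr; exact: cg.
  by apply: cvgMr; exact: continuous_is_derive (is_derive_expRN_half t).
- rewrite -[X in _ --> X](subr0 0); apply: cvgB; last exact: cvg_ginty.
  rewrite -[X in _ --> X](scaler0 _ (- (2 * C))); apply: cvgZr; exact: expRN_half_cvgy.
- by move=> t t0; case: (dF t t0).
- exact: F0.
- by move=> t; rewrite in_itv/= andbT => t0; rewrite derive1E; case: (dF t t0).
Qed.

Local Notation I a := (\int[mu]_(t in posl) (gint a t)%:E)%E.

Let integral_gint_fin_num a : 0 <= a -> I a \is a fin_num.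
Proof.
move=> a0; have [C C0 HC] := powR_le_expR_half a0.
have mE : measurable_fun posl (fun t : R => expR (- (t / 2))).
  apply: measurable_funTS; apply: measurableT_comp; first exact: measurable_expR.
  by apply: measurableT_comp => //; exact: measurable_funM.
have I0 : (0 <= I a)%E by apply: integral_ge0 => t _; rewrite lee_fin.
rewrite ge0_fin_numE//.
apply: (@le_lt_trans _ _ (\int[mu]_(t in posl) (C%:E * (expR (- (t / 2)))%:E))%E).
  apply: ge0_le_integral => //.
  - by move=> t _; rewrite lee_fin.
  - by apply/measurable_EFinP; exact: measurable_gint.
  - by apply: measurable_funeM; apply/measurable_EFinP.
  move=> t; rewrite /= in_itv/= andbT => /ltW t0; rewrite -EFinM lee_fin /gint.
  rewrite (le_trans (ler_wpM2r (expR_ge0 _) (HC _ t0)))//.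
  by rewrite -mulrA -expRD ler_pM2l// ler_expR; lra.
rewrite ge0_integralZl//.
- by rewrite integral_expRN_half -EFinM ltry.
- exact/measurable_EFinP.
- by rewrite lee_fin ltW.
Qed.

(** Integration by parts: [I (a + 1)] and [(a + 1) * I a] both complete the same finite integral [d]
    to [2 * C], and [d] cancels. *)
Let integral_gintS a : 0 <= a -> I (a + 1) = ((a + 1)%:E * I a)%E.
Proof.
move=> a0; have a1 : 0 <= a + 1 by rewrite addr_ge0.
have [C' C'0 HC'] := powR_le_expR_half a0.
pose C := (a + 1) * C'.
have C0 : 0 < C by rewrite mulr_gt0// ltr_wpDl.
have HC t : 0 <= t -> (a + 1) * t `^ a <= C * expR (t / 2).
  by move=> t0; rewrite /C -mulrA ler_wpM2l// HC'.
have Hnn t : posl t -> 0 <= C * expR (- (t / 2)) - (a + 1) * gint a t.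
  rewrite /= in_itv/= andbT => /ltW t0; rewrite subr_ge0 /gint mulrA.
  rewrite (le_trans (ler_wpM2r (expR_ge0 _) (HC _ t0)))//.
  by rewrite -mulrA -expRD ler_pM2l// ler_expR; lra.
have mE : measurable_fun posl (fun t : R => expR (- (t / 2))).
  apply: measurable_funTS; apply: measurableT_comp; first exact: measurable_expR.
  by apply: measurableT_comp => //; exact: measurable_funM.
have md : measurable_fun posl (fun t => C * expR (- (t / 2)) - (a + 1) * gint a t).
  by apply: measurable_funB; exact: measurable_funM.
pose d := (\int[mu]_(t in posl) (C * expR (- (t / 2)) - (a + 1) * gint a t)%:E)%E.
have E1 : (d + I (a + 1) = (2 * C)%:E)%E.
  rewrite -(integral_gint_aux a0 C0 HC) -ge0_integralD//.
  - exact/measurable_EFinP.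
  - by move=> t _; rewrite lee_fin.
  - by apply/measurable_EFinP; exact: measurable_gint.
have E2 : (d + (a + 1)%:E * I a = (2 * C)%:E)%E.
  rewrite -ge0_integralZl//; last 2 first.
  - by apply/measurable_EFinP; exact: measurable_gint.
  - by move=> t _; rewrite lee_fin.
  rewrite -ge0_integralD//; last 3 first.
  - exact/measurable_EFinP.
  - by move=> t _; rewrite -EFinM lee_fin mulr_ge0 ?gint_ge0.
  - by apply: measurable_funeM; apply/measurable_EFinP; exact: measurable_gint.
  rewrite mulrC EFinM -integral_expRN_half -ge0_integralZl//; last 2 first.
  - exact/measurable_EFinP.
  - by rewrite lee_fin ltW.
  by apply: eq_integral => t _ /=; rewrite -!EFinM -EFinD subrK.
have dfin : d \is a fin_num.
  rewrite ge0_fin_numE; last by apply: integral_ge0 => t pt; rewrite lee_fin; exact: Hnn.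
  apply: (@le_lt_trans _ _ (2 * C)%:E); last exact: ltry.
  by rewrite -E1 leeDl// integral_ge0// => t _; rewrite lee_fin.
by rewrite -[LHS](addeK _ dfin) -[RHS](addeK _ dfin) ![(_ + d)%E]addeC E1 E2.
Qed.

(** The bound [1 <= x] makes the exponent [x - 1] nonnegative, so the integrand stays bounded near
    0; all Gamma arguments met below are at least 1. *)
Lemma GammaS x : 1 <= x -> Gamma (x + 1) = x * Gamma x.
Proof.
move=> x1; have x0 : 0 <= x - 1 by rewrite subr_ge0.
rewrite /Gamma /Rintegral.
have := integral_gintS x0; rewrite /gint subrK addrK => ->.
by rewrite fineM// integral_gint_fin_num.
Qed.

Lemma Gamma_gt0 x : 1 <= x -> 0 < Gamma x.
Proof.
move=> x1; have x0 : 0 <= x - 1 by rewrite subr_ge0.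
rewrite lt_neqAle eq_sym andbC; apply/andP; split.
  by apply: Rintegral_ge0 => t _; exact: gint_ge0.
apply/negP => /eqP G0.
have : (0 < I (x - 1)%R)%E.
  apply: (@lt_le_trans _ _ (\int[mu]_(t in `[1%R, 2%R]) (expR (- 2))%:E)%E).
    rewrite integral_cst//= lebesgue_measure_itv/= lte_fin ltr1n -EFinB -EFinM lte_fin.
    by rewrite mulr_gt0 ?expR_gt0// subr_gt0 ltr1n.
  apply: (@le_trans _ _ (\int[mu]_(t in `[1%R, 2%R]) (gint (x - 1) t)%:E)%E).
    apply: ge0_le_integral => //.
    - by apply/measurable_EFinP; exact: measurable_gint.
    move=> t; rewrite /= in_itv/= => /andP[t1 t2]; rewrite lee_fin /gint.
    rewrite -[leLHS]mul1r ler_pM ?expR_ge0// ?ler_expR ?lerN2//.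
    have t0 : 0 <= t by exact: le_trans t1.
    have := @ge0_ler_powR R _ x0 1 t.
    by rewrite powR1 !nnegrE => /(_ ler01 t0 t1).
  apply: ge0_subset_integral => //.
  - by apply/measurable_EFinP; exact: measurable_gint.
  - by move=> t _; rewrite lee_fin.
  by move=> t; rewrite /= !in_itv/= andbT => /andP[t1 _]; exact: lt_le_trans t1.
rewrite -(fineK (integral_gint_fin_num x0)) lte_fin.
by rewrite -[fine _]/(Gamma x) G0 ltxx.
Qed.

Let integrable_gint a : 0 <= a -> mu.-integrable posl (EFin \o gint a).
Proof.
move=> a0; apply/integrableP; split; first by apply/measurable_EFinP; exact: measurable_gint.
under eq_integral do rewrite gee0_abs ?lee_fin ?gint_ge0//.
by rewrite -ge0_fin_numE ?integral_gint_fin_num// integral_ge0// => t _; rewrite lee_fin.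
Qed.

Lemma Gamma_log_convex x y s : 1 <= x -> 1 <= y -> 0 < s < 1 ->
  Gamma (s * x + (1 - s) * y) <= Gamma x `^ s * Gamma y `^ (1 - s).
Proof.
move=> x1 y1 /andP[s0 s1].
have s'0 : 0 < 1 - s by rewrite subr_gt0.
have x0 : 0 <= x - 1 by rewrite subr_ge0.
have y0 : 0 <= y - 1 by rewrite subr_ge0.
set z := s * x + (1 - s) * y.
have zE : z - 1 = s * (x - 1) + (1 - s) * (y - 1) by rewrite /z; ring.
have z0 : 0 <= z - 1 by rewrite zE addr_ge0// mulr_ge0// ltW.
have A0 := Gamma_gt0 x1; have B0 := Gamma_gt0 y1.
set A := Gamma x in A0 *; set B := Gamma y in B0 *.
have AB0 : 0 < A `^ s * B `^ (1 - s) by rewrite mulr_gt0// powR_gt0.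
pose cA := A `^ s * B `^ (1 - s) * s / A.
pose cB := A `^ s * B `^ (1 - s) * (1 - s) / B.
have cAB : cA * A + cB * B = A `^ s * B `^ (1 - s).
  have aux (u v w : R) : 0 < u -> 0 < v -> w * s / u * u + w * (1 - s) / v * v = w.
    by move=> u0 v0; rewrite !divfK ?gt_eqF// -mulrDr [s + _]addrC subrK mulr1.
  exact: aux A0 B0.
have young t : posl t -> gint (z - 1) t <= cA * gint (x - 1) t + cB * gint (y - 1) t.
  rewrite /= in_itv/= andbT => t0.
  have gE c : gint c t = expR (c * ln t - t) by rewrite /gint /powR gt_eqF// expRD.
  have -> : gint (z - 1) t = gint (x - 1) t `^ s * gint (y - 1) t `^ (1 - s).
    rewrite !gE /powR (gt_eqF (expR_gt0 _)) (gt_eqF (expR_gt0 _)) !expRK -expRD zE.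
    by congr expR; ring.
  by apply: weighted_amgm; rewrite ?gint_ge0 ?s0.
have iZ c a : 0 <= a -> mu.-integrable posl (EFin \o (fun t => c * gint a t)).
  move=> a0.
  exact: (@integrableZl _ _ _ mu posl (measurable_itv _) c _ (integrable_gint a0)).
have GE c : Gamma c = \int[mu]_(t in posl) gint (c - 1) t by [].
rewrite -cAB; move: cA cB young {cAB} => cA cB young; rewrite /A /B !GE.
rewrite -!RintegralZl ?integrable_gint// -RintegralD//; last 2 first.
- exact: iZ.
- exact: iZ.
apply: le_Rintegral; [exact: measurable_itv|exact: integrable_gint| |exact: young].
exact: (@integrableD _ _ _ mu posl (measurable_itv _) _ _ (iZ cA _ x0) (iZ cB _ y0)).
Qed.

End gamma.

#[local] Opaque Gamma.

(** * Growth of quotients of Gamma values *)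

Section gamma_quotient.
Context {R : realType} (alpha : R).
Hypothesis alpha_itv : 0 < alpha <= 1.

(** Normalised to grow like [x ^ (1 - alpha)], with exponent in [0, 1); divided by [x] it is the
    ratio of successive Kilbas-Saigo coefficients. *)
Definition Gamma_quotient (x : R) : R := Gamma (x + 1) / Gamma (x + alpha).

Let alpha0 : 0 < alpha. Proof. by case/andP: alpha_itv. Qed.
Let alpha1 : alpha <= 1. Proof. by case/andP: alpha_itv. Qed.

Let addr_ge1 (x y : R) : 1 <= x -> 0 <= y -> 1 <= x + y.
Proof. by move=> x1 y0; rewrite (le_trans x1)// lerDl. Qed.

Lemma Gamma_quotient_gt0 x : 1 <= x -> 0 < Gamma_quotient x.
Proof.
by move=> x1; rewrite divr_gt0// Gamma_gt0// addr_ge1// ltW.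
Qed.

(** Wendel's inequalities: log-convexity is used once with [x + alpha] between [x] and [x + 1], once
    with [x + 1] between [x + alpha] and [x + alpha + 1]. *)
Lemma Gamma_quotient_bounds x : 1 <= x ->
  x `^ (1 - alpha) <= Gamma_quotient x <= (x + alpha) `^ (1 - alpha).
Proof.
move=> x1; have x0 : 0 < x by rewrite (lt_le_trans ltr01).
have xa1 : 1 <= x + alpha by rewrite addr_ge1// ltW.
have [a1|an1] := eqVneq alpha 1.
  rewrite /Gamma_quotient a1 subrr !powRr0 mulfV ?lexx//.
  by rewrite gt_eqF// Gamma_gt0// addr_ge1.
have a1 : alpha < 1 by rewrite lt_neqAle an1.
have a'1 : 0 < 1 - alpha < 1 by rewrite subr_gt0 a1/= gtrBl.
have Gxa := Gamma_gt0 xa1; have Gx := Gamma_gt0 x1.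
apply/andP; split.
  rewrite (ler_pdivlMr _ _ Gxa).
  have := @Gamma_log_convex _ x (x + 1) (1 - alpha) x1 (addr_ge1 x1 ler01) a'1.
  rewrite (_ : (1 - alpha) * x + _ = x + alpha); last by ring.
  rewrite opprB addrCA subrr addr0 (GammaS x1) (powRM _ (ltW x0) (ltW Gx)).
  rewrite mulrCA -powRD; last by rewrite (gt_eqF Gx)/= implybT.
  rewrite subrK (powRr1 (ltW Gx)) => H.
  rewrite (le_trans (ler_wpM2l (powR_ge0 _ _) H))// mulrA -powRD; last first.
    by rewrite (gt_eqF x0)/= implybT.
  by rewrite subrK powRr1// ltW.
rewrite (ler_pdivrMr _ _ Gxa).
have := @Gamma_log_convex _ (x + alpha) (x + alpha + 1) alpha xa1 (addr_ge1 xa1 ler01).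
rewrite alpha0 a1 => /(_ isT).
rewrite (_ : alpha * (x + alpha) + _ = x + 1); last by ring.
rewrite (GammaS xa1) powRM ?(ltW Gxa)//; last by rewrite (le_trans _ xa1).
rewrite mulrCA -powRD; last by rewrite (gt_eqF Gxa)/= implybT.
by rewrite addrCA subrr addr0 powRr1 ?(ltW Gxa).
Qed.

Lemma Gamma_quotient_div x : 1 <= x -> Gamma x / Gamma (x + alpha) = Gamma_quotient x / x.
Proof.
move=> x1; rewrite /Gamma_quotient (GammaS x1) [x * _]mulrC -!mulrA; congr (_ * _).
by rewrite [_^-1 * _]mulrC mulVKf// gt_eqF// (lt_le_trans ltr01).
Qed.

Lemma Gamma_quotientS x : 1 <= x ->
  Gamma_quotient x = (x + alpha) / (x + 1) * Gamma_quotient (x + 1).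
Proof.
move=> x1; have x0 : 0 < x by rewrite (lt_le_trans ltr01).
have xa1 : 1 <= x + alpha by rewrite addr_ge1// ltW.
have x11 : 1 <= x + 1 by rewrite addr_ge1.
rewrite /Gamma_quotient (GammaS x11) addrAC (GammaS xa1).
have G1 := Gamma_gt0 xa1; have Gx := Gamma_gt0 x11.
have xa0 : 0 < x + alpha by rewrite addr_gt0.
by field; rewrite (gt_eqF G1) (gt_eqF xa0) gt_eqF// ltr_wpDl// ltW.
Qed.

Let quotient_ratio_le x y d : 1 <= x -> 1 <= y -> 0 <= d -> x + alpha <= y + d ->
  Gamma_quotient x / Gamma_quotient y <= 1 + d / y.
Proof.
move=> x1 y1 d0 xyd; have x0 : 0 < x by rewrite (lt_le_trans ltr01).
have y0 : 0 < y by rewrite (lt_le_trans ltr01).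
have [/andP[_ xle] /andP[yge _]] := (Gamma_quotient_bounds x1, Gamma_quotient_bounds y1).
have xa0 : 0 <= x + alpha by rewrite addr_ge0// ltW.
have a'0 : 0 <= 1 - alpha by rewrite subr_ge0.
rewrite ler_pdivrMr ?Gamma_quotient_gt0// (le_trans xle)//.
have r1 : 1 <= 1 + d / y by rewrite lerDl divr_ge0// ltW.
have r0 : 0 <= 1 + d / y by rewrite (le_trans _ r1).
rewrite (le_trans _ (ler_wpM2l r0 yge))//.
apply: (@le_trans _ _ ((1 + d / y) `^ (1 - alpha) * y `^ (1 - alpha))).
  rewrite -powRM ?(ltW y0)// ge0_ler_powR ?nnegrE//; first by rewrite mulr_ge0// ltW.
  by rewrite mulrDl mul1r divfK ?gt_eqF.
by rewrite ler_wpM2r ?powR_ge0// -[leRHS]powRr1// ler_powR// gerBl ltW.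
Qed.

(** [quotient_ratio_le] bounds the ratio from above and, with [x] and [y] exchanged, its inverse;
    the ratio is squeezed to 1. *)
Lemma Gamma_quotient_ratio_cvg x y : 1 <= x -> 1 <= y ->
  Gamma_quotient (x + n%:R) / Gamma_quotient (y + n%:R) @[n --> \oo] --> (1 : R).
Proof.
move=> x1 y1.
have xn1 (z : R) n : 1 <= z -> 1 <= z + n%:R by move=> z1; rewrite addr_ge1.
have gt0 (z : R) n : 1 <= z -> 0 < z + n%:R by move=> z1; rewrite (lt_le_trans ltr01)// xn1.
have bnd (w z : R) : 1 <= w -> 1 <= z ->
    1 + (w + alpha) / (z + n%:R) @[n --> \oo] --> (1 : R).
  move=> w1 z1; rewrite -[X in _ --> X]addr0; apply: cvgD; first exact: cvg_cst.
  rewrite -[X in _ --> X](mulr0 (w + alpha)); apply: cvgMr.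
  apply/(@gtr0_cvgV0 _ _ _ _ (fun m : nat => z + m%:R)); first by near=> m; rewrite gt0.
  apply: (@ger_cvgy _ _ _ _ (fun m : nat => m%:R)); last exact: cvgr_idn.
  by near=> m; rewrite lerDr (le_trans _ z1).
have ub (w z : R) n : 1 <= w -> 1 <= z ->
    Gamma_quotient (w + n%:R) / Gamma_quotient (z + n%:R) <= 1 + (w + alpha) / (z + n%:R).
  move=> w1 z1; have w0 : 0 <= w by rewrite (le_trans ler01).
  apply: quotient_ratio_le; rewrite ?xn1 ?addr_ge0 ?(ltW alpha0)//.
  by rewrite addrAC [leRHS]addrC lerD2l lerDr (le_trans ler01).
apply: (@squeeze_cvgr _ _ _ _ (fun n => (1 + (y + alpha) / (x + n%:R))^-1)
  (fun n => 1 + (x + alpha) / (y + n%:R))).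
- near=> n; rewrite ub// andbT -[leRHS]invrK lef_pV2 ?posrE.
  + by rewrite invf_div ub.
  + by rewrite addr_gt0// divr_gt0 ?gt0// addr_gt0// (lt_le_trans ltr01).
  + by rewrite invr_gt0 divr_gt0// Gamma_quotient_gt0// xn1.
- by rewrite -[X in _ --> X]invr1; apply: cvgV; [rewrite oner_neq0|exact: bnd].
- exact: bnd.
Unshelve. all: by end_near. Qed.

End gamma_quotient.

(** * Kilbas-Saigo functions *)

Section gamma_product_series.
Context {R : realType}.
Implicit Types (c : nat -> R) (x z : R).

Definition gprod c (k : nat) : R := \prod_(0 <= j < k) c j.

Lemma gprodS c k : gprod c k.+1 = gprod c k * c k.
Proof. by rewrite /gprod big_nat_recr. Qed.

Lemma gprodSl c k : gprod c k.+1 = c 0%N * gprod (fun j => c j.+1) k.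
Proof. by rewrite /gprod big_nat_recl. Qed.

Lemma gprod_gt0 c k : (forall j, 0 < c j) -> 0 < gprod c k.
Proof. by move=> c0; apply: prodr_gt0 => j _; exact: c0. Qed.

Definition gseries c z := series (fun k => gprod c k * z ^+ k).

Lemma is_cvg_gseries c z : (forall j, 0 < c j) ->
  (exists K, forall j, (K <= j)%N -> c j * `|z| <= 2^-1) -> cvgn (gseries c z).
Proof.
move=> c0 [K KP]; apply: normed_cvg.
(* Since [c j * |z| <= m j / 2], the series is compared with a geometric one of ratio 1/2; the
   factors [m j] are 1 from [K] on, so their products stay below [gprod m K]. *)
pose m j := Num.max 1 (2 * (c j * `|z|)).
have m1 j : 1 <= m j by rewrite le_max lexx.
have mK j : (K <= j)%N -> m j = 1.
  move=> /KP cz; apply/max_idPl.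
  by rewrite -(ler_pM2l (ltr0n R 2)) mulfV// in cz.
have bnd k : gprod m k <= gprod m K.
  apply: (@le_trans _ _ (gprod m (K + k))).
    rewrite addnC; elim: K {KP mK} => [|K IH]; first by rewrite addn0.
    rewrite addnS gprodS (le_trans IH)// ler_peMr//.
    by apply: prodr_ge0 => j _; rewrite (le_trans ler01).
  elim: k => [|k IH]; first by rewrite addn0.
  by rewrite addnS gprodS mK ?leq_addr// mulr1.
apply: (@series_le_cvg _ _ (fun k => gprod m K * 2^-1 ^+ k)).
- by move=> k; exact: normr_ge0.
- by move=> k; rewrite mulr_ge0 ?exprn_ge0//; apply: prodr_ge0 => j _;
    rewrite (le_trans ler01).
- move=> k; apply: (@le_trans _ _ (gprod m k * 2^-1 ^+ k)); last first.
    by rewrite ler_wpM2r// exprn_ge0.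
  rewrite /= normrM normrX ger0_norm ?(ltW (gprod_gt0 _ _))//.
  elim: k => [|k IH]; first by rewrite /gprod !big_geq.
  rewrite !gprodS !exprSr.
  rewrite [leLHS](_ : _ = gprod c k * `|z| ^+ k * (c k * `|z|)); last by ring.
  rewrite [leRHS](_ : _ = gprod m k * 2^-1 ^+ k * (m k / 2)); last by ring.
  apply: ler_pM => //; [by rewrite mulr_ge0 ?exprn_ge0// ltW// gprod_gt0|by rewrite mulr_ge0 ?(ltW (c0 _))|].
  by rewrite ler_pdivlMr// mulrC le_max lexx orbT.
- apply: is_cvg_geometric_series.
  by rewrite ger0_norm// invf_lt1// ltr1n.
Qed.

Definition gsum c z := limn (gseries c z).

(** This links the two Kilbas-Saigo functions of the solution: the coefficient ratios of the second
    are those of the first, shifted by one index. *)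
Lemma gsum_shift c z : cvgn (gseries c z) -> cvgn (gseries (fun j => c j.+1) z) ->
  gsum c z = 1 + c 0%N * z * gsum (fun j => c j.+1) z.
Proof.
move=> cv cvS; apply/cvg_lim => //; rewrite -cvg_shiftS.
rewrite [X in X @ _](_ : _ =
    fun n => 1 + c 0%N * z * gseries (fun j => c j.+1) z n); last first.
  apply/funext => n; rewrite /gseries /series/= big_nat_recl//= expr0.
  rewrite {1}/gprod big_geq//.
  rewrite mul1r mulr_sumr; congr (_ + _); apply: eq_bigr => k _.
  by rewrite gprodSl exprS; ring.
by apply: cvgD; [exact: cvg_cst|exact: cvgMr].
Qed.

Section moments.
Variable c : nat -> R.
Hypothesis c_gt0 : forall j, 0 < c j.
Hypothesis c_moment : moment_seq (fun k => k`!%:R * gprod c k).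
Hypothesis c_cvg : forall z, cvgn (gseries c z).

Let alt_gseries x n : alt_sum (fun k => k`!%:R * gprod c k) x n = gseries c (- x) n.
Proof.
apply: eq_bigr => k _; have : k`!%:R != 0 :> R by rewrite pnatr_eq0 -lt0n fact_gt0.
by move=> k0; field.
Qed.

Let cvg_even z : gseries c z n.*2 @[n --> \oo] --> gsum c z.
Proof.
apply: (@cvg_comp _ _ _ (fun n => n.*2) (gseries c z) \oo \oo); last exact: c_cvg.
by apply/cvgnyPge => N; near=> n; rewrite (@leq_trans n)//; [near: n; exact: nbhs_infty_ge|
  rewrite -addnn leq_addr].
Unshelve. all: by end_near. Qed.

Let cvg_odd z : gseries c z n.*2.+1 @[n --> \oo] --> gsum c z.
Proof.
apply: (@cvg_comp _ _ _ (fun n => n.*2.+1) (gseries c z) \oo \oo); last exact: c_cvg.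
by apply/cvgnyPge => N; near=> n; rewrite (@leq_trans n)//; [near: n; exact: nbhs_infty_ge|
  rewrite -addnn ltnW// ltnS leq_addr].
Unshelve. all: by end_near. Qed.

(** Only the even sums at [- z] pass to the limit; the odd sum at [- x] stays finite because
    [gsum_lt1] needs it with three terms. *)
Lemma gsum_le_gseries x z n : 0 <= x <= z -> gsum c (- z) <= gseries c (- x) n.*2.+1.
Proof.
move=> xz; apply: (cvgr_to_le (@cvg_even (- z))); near=> m.
by rewrite -!alt_gseries; exact: moment_seq_alt_sum.
Unshelve. all: by end_near. Qed.

Lemma gsum_ge0 z : 0 <= z -> 0 <= gsum c (- z).
Proof.
move=> z0; apply: (cvgr_to_ge (@cvg_odd (- z))); near=> m.
by rewrite -!alt_gseries; exact: moment_seq_alt_sum_ge0.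
Unshelve. all: by end_near. Qed.

Lemma gsum_le x z : 0 <= x <= z -> gsum c (- z) <= gsum c (- x).
Proof.
move=> xz; apply: (cvgr_to_ge (@cvg_odd (- x))); near=> m.
exact: gsum_le_gseries.
Unshelve. all: by end_near. Qed.

Lemma gsum_lt1 z : 0 < z -> gsum c (- z) < 1.
Proof.
(* For this [x] the quadratic term is at most half the linear one, so the three-term sum at [- x] is
   at most [1 - c 0 * x / 2]. *)
move=> z0; pose x := Num.min z (2 * c 1%N)^-1.
have x0 : 0 < x by rewrite lt_min z0 invr_gt0 mulr_gt0.
have xz : 0 <= x <= z by rewrite (ltW x0)/= ge_min lexx.
apply: le_lt_trans (gsum_le_gseries 1 xz) _.
rewrite /gseries /series/= !big_nat_recr//= big_geq// add0r !gprodS /gprod big_geq// !mul1r.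
have : c 1%N * x <= 2^-1.
  rewrite -ler_pdivlMl// (le_trans (_ : _ <= (2 * c 1%N)^-1)) ?ge_min ?lexx ?orbT//.
  by rewrite invfM mulrC.
rewrite -(ler_pM2l (mulr_gt0 (c_gt0 0%N) x0)) => H.
have := mulr_gt0 (c_gt0 0%N) x0; move: H; rewrite expr0 expr1; nra.
Qed.

End moments.

End gamma_product_series.

#[local] Opaque Gamma_quotient.

(** * The two Mittag-Leffler functions of the solution *)

Section kilbas_saigo_bounds.
Context {R : realType} (alpha beta : R).
Hypothesis alpha_itv : 0 < alpha <= 1.
Hypothesis beta_ge0 : 0 <= beta.

Let alpha0 : 0 < alpha. Proof. by case/andP: alpha_itv. Qed.
Let alpha1 : alpha <= 1. Proof. by case/andP: alpha_itv. Qed.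

Local Notation gamma := (alpha + beta).
Let gamma0 : 0 < gamma. Proof. by rewrite ltr_pwDl. Qed.

(** The Gamma argument [alpha * (j * m + n) + 1] for [m = 1 + beta / alpha] and
    [n = beta / alpha]. *)
Let xs (j : nat) : R := j%:R * gamma + beta + 1.
Let cs (j : nat) : R := Gamma (xs j) / Gamma (xs j + alpha).

Let xs_ge1 j : 1 <= xs j.
Proof. by rewrite /xs lerDr addr_ge0// mulr_ge0// ltW. Qed.

Let cs_gt0 j : 0 < cs j.
Proof.
by apply: divr_gt0; apply: Gamma_gt0 => //; rewrite (le_trans (xs_ge1 j))// lerDl ltW.
Qed.

Let csE j : cs j = Gamma_quotient alpha (xs j) / xs j.
Proof. exact: Gamma_quotient_div. Qed.

(* Unrolling [Gamma (x + 1) = x Gamma x] over [i <= n] in [cs j] gives the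
   product of [(j + B i) / (j + A i)]; since [alpha <= 1], [B i <= A i.+1], so that
   pairing [B i] with [A i.+1] and the factorial with [A 0] leaves only ratios
   of rising factorials covered by [moment_seq_rising_ratio]. *)
Let A (i : nat) : R := (1 + i%:R + beta) / gamma.
Let B (i : nat) : R := (1 + i%:R + gamma) / gamma.

Let A_gt0 i : 0 < A i.
Proof. by rewrite divr_gt0// -addrA ltr_pwDl// addr_ge0. Qed.

Let B_gt0 i : 0 < B i.
Proof. by rewrite divr_gt0// -addrA ltr_pwDl// addr_ge0// ltW. Qed.

Let A0_ge1 : 1 <= A 0.
Proof. by rewrite ler_pdivlMr// mul1r addr0 lerD2r. Qed.

Let BA i : B i <= A i.+1.
Proof. by rewrite ler_pM2r ?invr_gt0// -natr1; move: alpha1; lra. Qed.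

Let factors n (k : nat) : R := rising 1 k / rising (A 0) k *
  \prod_(0 <= i < n) (rising (B i) k / rising (A i.+1) k).

Let factor_step n j : j.+1%:R * cs j = (1 + j%:R) / (A 0 + j%:R) *
  (\prod_(0 <= i < n) ((B i + j%:R) / (A i.+1 + j%:R))) *
  (Gamma_quotient alpha (xs j + n%:R) / gamma).
Proof.
have g0 : gamma != 0 by rewrite gt_eqF.
elim: n => [|n ->].
  rewrite big_geq// mulr1 addr0 csE -natr1.
  have -> : A 0 + j%:R = xs j / gamma by rewrite /A /xs; field.
  have x0 : xs j != 0 by rewrite gt_eqF// (lt_le_trans ltr01).
  by field; rewrite x0 g0.
have xn1 : 1 <= xs j + n%:R by rewrite (le_trans (xs_ge1 j))// lerDl.
rewrite (Gamma_quotientS alpha_itv xn1).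
rewrite big_nat_recr//=.
rewrite -[in RHS]natr1.
have -> : B n + j%:R = (xs j + n%:R + alpha) / gamma by rewrite /B /xs; field.
have -> : A n.+1 + j%:R = (xs j + n%:R + 1) / gamma by rewrite /A /xs -natr1; field.
have x0 : xs j + n%:R + 1 != 0.
  by rewrite gt_eqF// ltr_pwDr// (le_trans _ xn1).
rewrite addrA; move: (\prod_(_ <= _ < _) _) (Gamma_quotient _ _) => u v.
have a0 : A 0 + j%:R != 0 by rewrite gt_eqF// ltr_pwDl.
by field; rewrite x0 g0 a0.
Qed.

Let factorial_gprod n k : k`!%:R * gprod cs k =
  factors n k * \prod_(0 <= j < k) (Gamma_quotient alpha (xs j + n%:R) / gamma).
Proof.
elim: k => [|k IH].
  rewrite /factors big1 => [|i _]; last by rewrite /rising !big_geq// divr1.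
  by rewrite /rising /gprod !big_geq// fact0 divr1 !mulr1.
rewrite gprodS factS natrM [RHS](_ : _ = factors n k *
    \prod_(0 <= j < k) (Gamma_quotient alpha (xs j + n%:R) / gamma) * (k.+1%:R * cs k)).
  by rewrite -IH; ring.
rewrite (factor_step n) big_nat_recr//= /factors.
have rS (a : R) m : rising a m.+1 = rising a m * (a + m%:R) by rewrite /rising big_nat_recr.
rewrite !rS invfM.
under eq_bigr do rewrite !rS -mulf_div.
rewrite big_split/=; ring.
Qed.

Let gamma_moment : moment_seq (fun k => k`!%:R * gprod cs k).
Proof.
(* In [factorial_gprod] the Gamma quotients vary with [j]; freezing them at [xs 0] gives a power in
   [k], and [Q n] is the correction tending to 1. *)
pose T n k := (Gamma_quotient alpha (xs 0 + n%:R) / gamma) ^+ k * factors n k.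
apply: (@moment_seq_lim _ T) => [n|k].
  apply: moment_seqM.
    by apply: moment_seqX; rewrite divr_ge0 ?(ltW gamma0)// ltW// Gamma_quotient_gt0//
      (le_trans (xs_ge1 0))// lerDl.
  apply: moment_seqM; first exact: moment_seq_rising_ratio.
  by apply: moment_seq_prod => i; exact: moment_seq_rising_ratio.
pose Q n := \prod_(0 <= j < k)
  (Gamma_quotient alpha (xs 0 + n%:R) / Gamma_quotient alpha (xs j + n%:R)).
rewrite [X in X @ _](_ : _ = fun n => k`!%:R * gprod cs k * Q n); last first.
  apply/funext => n; rewrite (factorial_gprod n) /T /Q mulrC -mulrA; congr (_ * _).
  rewrite -big_split/= -[k in _ ^+ k]subn0 -prodr_const_nat; apply: eq_bigr => j _.
  have : Gamma_quotient alpha (xs j + n%:R) != 0.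
    by rewrite gt_eqF// Gamma_quotient_gt0// (le_trans (xs_ge1 j))// lerDl.
  move: (Gamma_quotient _ _) (Gamma_quotient _ _) => u v v0.
  by field; rewrite v0 gt_eqF.
rewrite -[X in _ --> X]mulr1; apply: cvgMr; rewrite /Q.
elim: k {T Q} => [|k IH].
  by rewrite [X in X @ _](_ : _ = cst 1);
    [exact: cvg_cst|apply/funext => n; rewrite big_geq].
rewrite [X in X @ _](_ : _ = fun n => \prod_(0 <= j < k)
    (Gamma_quotient alpha (xs 0 + n%:R) / Gamma_quotient alpha (xs j + n%:R)) *
    (Gamma_quotient alpha (xs 0 + n%:R) / Gamma_quotient alpha (xs k + n%:R))).
  rewrite -[X in _ --> X]mulr1; apply: cvgM => //.
  exact: Gamma_quotient_ratio_cvg.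
by apply/funext => n; rewrite big_nat_recr.
Qed.

(** As [xs j + alpha <= 2 * xs j], the upper Wendel bound gives [cs j <= 2 / xs j ^ alpha], so the
    coefficient ratios tend to 0. *)
Let xs_ge_cs j (e : R) : 0 < e -> e^-1 * 2 <= xs j `^ alpha -> cs j <= e.
Proof.
move=> e0 He; have x1 := xs_ge1 j; have x0 : 0 < xs j by rewrite (lt_le_trans ltr01).
rewrite csE ler_pdivrMr//.
have /andP[_ /le_trans] := Gamma_quotient_bounds alpha_itv x1; apply.
apply: (@le_trans _ _ ((2 * xs j) `^ (1 - alpha))).
  have x20 : 0 <= 2 * xs j by rewrite mulr_ge0// ltW.
  have xa0 : 0 <= xs j + alpha by rewrite addr_ge0// ltW.
  rewrite ge0_ler_powR ?nnegrE ?subr_ge0//.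
  by move: (xs j) x1 alpha1 => w; lra.
rewrite powRM ?(ltW x0)//.
apply: (@le_trans _ _ (2 * xs j `^ (1 - alpha))).
  rewrite ler_wpM2r ?powR_ge0// -[leRHS]powRr1// ler_powR ?ler1n// gerBl ltW//.
have -> : xs j `^ (1 - alpha) = xs j / xs j `^ alpha.
  by rewrite powRB ?powRr1 ?(ltW x0)// (gt_eqF x0) implybT.
have xa0 : 0 < xs j `^ alpha by rewrite powR_gt0.
rewrite mulrA ler_pdivrMr// [leRHS]mulrAC ler_pM2r//.
by move: He; rewrite ler_pdivrMl.
Qed.

(** The choices [f = id] and [f = S] serve the first and the second Mittag-Leffler function. *)
Let is_cvg_cs (f : nat -> nat) z : (forall j, (j <= f j)%N) ->
  cvgn (gseries (cs \o f) z).
Proof.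
move=> fj; apply: is_cvg_gseries; first by move=> j; exact: cs_gt0.
have z1 : 0 < 2 * (`|z| + 1) by rewrite mulr_gt0// ltr_wpDl.
pose M := (2 * (`|z| + 1)) * 2.
have M0 : 0 <= M by rewrite mulr_ge0// ltW.
pose K := Num.bound (M `^ alpha^-1 / gamma).
exists K => j Kj.
have csj : cs (f j) <= (2 * (`|z| + 1))^-1.
  apply: xs_ge_cs; first by rewrite invr_gt0.
  rewrite invrK -/M -[leLHS]powRr1// -(mulVf (lt0r_neq0 alpha0)) powRrM.
  rewrite ge0_ler_powR ?nnegrE ?powR_ge0 ?(ltW alpha0) ?(le_trans ler01)//.
  rewrite /xs -addrA (@le_trans _ _ ((f j)%:R * gamma))//; last by rewrite lerDl addr_ge0.
  rewrite -ler_pdivrMr// (@le_trans _ _ K%:R)//; last by rewrite ler_nat (leq_trans Kj).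
  by apply: ltW; apply: archi_boundP; rewrite divr_ge0 ?powR_ge0// ltW.
rewrite /= (le_trans (ler_wpM2r (normr_ge0 _) csj))// invfM -mulrA ler_piMr//.
by rewrite mulrC ler_pdivrMr ?mul1r ?lerDl// ltr_wpDl.
Qed.

Let kilbas_saigoE m n (c : nat -> R) z :
  (forall j, Gamma (alpha * (j%:R * m + n) + 1) /
    Gamma (alpha * (j%:R * m + n + 1) + 1) = c j) ->
  cvgn (gseries c z) -> kilbas_saigo alpha m n z = gsum c z.
Proof.
move=> cE cv; rewrite /kilbas_saigo.
(* The sum in [kilbas_saigo] starts at [k = 1]; its separate leading 1 is the term [k = 0] of
   [gseries]. *)
apply: (@addrI _ (-1)); rewrite addKr; apply/cvg_lim => //; rewrite -cvg_shiftS.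
rewrite [X in X @ _](_ : _ = fun K => -1 + gseries c z K.+1); last first.
  apply/funext => K; rewrite /gseries /series/= [in RHS]big_nat_recl//.
  rewrite expr0 (_ : gprod c 0 = 1) ?mulr1 ?addKr ?big_add1/=; last by rewrite /gprod big_geq.
  apply: eq_bigr => k _.
  by congr (_ * _); apply: eq_bigr => j _; rewrite cE.
by apply: cvgD; [exact: cvg_cst|rewrite (cvg_shiftS (gseries c z))].
Qed.

Definition mittag_leffler (z : R) :=
  kilbas_saigo alpha (1 + beta / alpha) (beta / alpha) (- z).

Let an0 : alpha != 0. Proof. by rewrite gt_eqF. Qed.

Let mittag_lefflerE z : mittag_leffler z = gsum cs (- z).
Proof.
apply: kilbas_saigoE => [j|]; last by apply: (@is_cvg_cs id).
rewrite /cs /xs; congr (Gamma _ / Gamma _); first by field.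
by field.
Qed.

Lemma mittag_leffler_ge0 z : 0 <= z -> 0 <= mittag_leffler z.
Proof.
move=> z0; rewrite mittag_lefflerE; apply: gsum_ge0 => // y.
exact: (@is_cvg_cs id).
Qed.

Lemma mittag_leffler_le x z : 0 <= x <= z -> mittag_leffler z <= mittag_leffler x.
Proof.
move=> xz; rewrite !mittag_lefflerE; apply: gsum_le => // y.
exact: (@is_cvg_cs id).
Qed.

Lemma mittag_leffler_lt1 z : 0 < z -> mittag_leffler z < 1.
Proof.
move=> z0; rewrite mittag_lefflerE; apply: gsum_lt1 => // y.
exact: (@is_cvg_cs id).
Qed.

(** [eta2 alpha beta] is [cs 0], which makes this [gsum_shift] at [- z]. *)
Lemma eta2_kilbas_saigo z : eta2 alpha beta * z *
    kilbas_saigo alpha (1 + beta / alpha) (1 + 2 * beta / alpha) (- z) =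
  1 - mittag_leffler z.
Proof.
rewrite mittag_lefflerE gsum_shift; [|exact: (@is_cvg_cs id)|exact: (@is_cvg_cs S)].
rewrite (@kilbas_saigoE _ _ (fun j => cs j.+1)); last exact: (@is_cvg_cs S).
  rewrite /eta2 /cs /xs mul0r add0r [beta + 1]addrC [1 + alpha + beta]addrAC.
  ring.
move=> j; rewrite /cs /xs -natr1; congr (Gamma _ / Gamma _); first by field.
by field.
Qed.

End kilbas_saigo_bounds.

(** * Eigenfunction expansions *)

Section L2_expansions.
Context {R : realType} {n : nat} {Omega : smooth_domain R n}.
Implicit Types (f g v w : 'rV[R]_n -> R) (c : nat -> R).
Local Notation L2 := (L2 Omega).
Local Notation "''<|' f , g '|>'" := (L2inner Omega f g) (format "''<|' f ,  g '|>'").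
Local Notation norm := (L2norm Omega).
Local Notation mu := (domain_measure Omega).

Lemma L2_integrableM f g : f \in L2 -> g \in L2 ->
  mu.-integrable [set: 'rV[R]_n] (EFin \o (fun x => f x * g x)).
Proof. by move=> fL gL; apply/Lfun1_integrable; exact: Lfun2_mul_Lfun1. Qed.

Lemma L2_lincomb (a : R) f g : f \in L2 -> g \in L2 -> (fun x => a * f x + g x) \in L2.
Proof.
move=> fL gL; have [_ +] := Lfun_submod_closed mu (lee1n 2).
by move=> /(_ a f g fL gL).
Qed.

Lemma L2_0 : (fun=> 0) \in L2.
Proof. by have [] := Lfun_submod_closed mu (lee1n 2). Qed.

Lemma L2_sub f g : f \in L2 -> g \in L2 -> (f \- g) \in L2.
Proof.
move=> fL gL; rewrite (_ : f \- g = fun x => -1 * g x + f x); first exact: L2_lincomb.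
by apply/funext => x /=; rewrite mulN1r addrC.
Qed.

Lemma L2innerC f g : '<|f, g|> = '<|g, f|>.
Proof. by apply: eq_Rintegral => x _; rewrite mulrC. Qed.

Lemma L2inner_lincombl (a : R) f g w : f \in L2 -> g \in L2 -> w \in L2 ->
  '<|fun x => a * f x + g x, w|> = a * '<|f, w|> + '<|g, w|>.
Proof.
move=> fL gL wL; have fw := L2_integrableM fL wL; have gw := L2_integrableM gL wL.
rewrite /L2inner -(RintegralZl _ _ fw)// -RintegralD//; last first.
  exact: (@integrableZl _ _ _ mu setT measurableT a _ fw).
by apply: eq_Rintegral => x _; ring.
Qed.

Lemma L2inner0l w : '<|fun=> 0, w|> = 0.
Proof.
by rewrite /L2inner /Rintegral; under eq_integral do rewrite mul0r; rewrite integral0.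
Qed.

Lemma L2inner_subl f g w : f \in L2 -> g \in L2 -> w \in L2 ->
  '<|f \- g, w|> = '<|f, w|> - '<|g, w|>.
Proof.
move=> fL gL wL.
rewrite (_ : f \- g = (fun x => -1 * g x + f x)).
  by rewrite L2inner_lincombl// mulN1r addrC.
by apply/funext => x /=; ring.
Qed.

Lemma L2norm_ge0 f : 0 <= norm f.
Proof. by apply: fine_ge0; exact: Lnorm_ge0. Qed.

Lemma sqr_L2norm f : norm f ^+ 2 = '<|f, f|>.
Proof.
have two0 : 2 != 0 :> R by rewrite pnatr_eq0.
have := powR_Lnorm mu (EFin \o f) two0 => /(congr1 fine); rewrite fine_poweR -/(norm f) powR_mulrn ?L2norm_ge0// => ->.
congr fine; apply: eq_integral => x _ /=.
by rewrite powR_mulrn// real_normK ?num_real.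
Qed.

Lemma ae_L2inner f f' g : f \in L2 -> f' \in L2 -> g \in L2 ->
  {ae mu, forall x, f x = f' x} -> '<|f, g|> = '<|f', g|>.
Proof.
move=> fL f'L gL ff'; congr fine; apply: ae_eq_integral => //.
- by have /integrableP[] := L2_integrableM fL gL.
- by have /integrableP[] := L2_integrableM f'L gL.
by apply: filterS ff' => x /= -> _.
Qed.

(** * Coefficients in an orthonormal family: Bessel and Parseval bounds *)

Section orthonormal.
Variable phi : nat -> 'rV[R]_n -> R.
Hypothesis phiL2 : forall k, phi k \in L2.
Hypothesis phi_on : forall j k, '<|phi j, phi k|> = (j == k)%:R.

Definition expansion c K : 'rV[R]_n -> R := fun y => \sum_(0 <= j < K) c j * phi j y.

Lemma expansionS c K : expansion c K.+1 = fun y => c K * phi K y + expansion c K y.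
Proof. by apply/funext => y; rewrite /expansion big_nat_recr//= addrC. Qed.

Lemma expansion_L2 c K : expansion c K \in L2.
Proof.
elim: K => [|K IH]; last by rewrite expansionS; exact: L2_lincomb.
rewrite (_ : expansion c 0 = fun=> 0); first exact: L2_0.
by apply/funext => y; rewrite /expansion big_geq.
Qed.

Lemma L2inner_expansion c K w : w \in L2 ->
  '<|expansion c K, w|> = \sum_(0 <= j < K) c j * '<|phi j, w|>.
Proof.
move=> wL; elim: K => [|K IH].
  rewrite (_ : expansion c 0 = fun=> 0) ?L2inner0l ?big_geq//.
  by apply/funext => y; rewrite /expansion big_geq.
by rewrite expansionS L2inner_lincombl// ?expansion_L2// IH big_nat_recr//= addrC.
Qed.

Lemma L2inner_expansion_phi c K k :
  '<|expansion c K, phi k|> = if (k < K)%N then c k else 0.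
Proof.
rewrite L2inner_expansion//; under eq_bigr do rewrite phi_on.
case: ifPn => kK.
  rewrite (bigD1_seq k) ?mem_index_iota ?iota_uniq//= eqxx mulr1 big1 ?addr0//.
  by move=> j /negPf ->; rewrite mulr0.
rewrite big_nat big1// => j /andP[_ jK]; rewrite (_ : (j == k) = false) ?mulr0//.
by apply/negP => /eqP jk; move: kK; rewrite -jk jK.
Qed.

Lemma sqr_L2norm_sub_expansion w K : w \in L2 ->
  norm (w \- expansion (fun k => '<|w, phi k|>) K) ^+ 2 =
  norm w ^+ 2 - \sum_(0 <= k < K) '<|w, phi k|> ^+ 2.
Proof.
move=> wL; set c := fun k => _; set e := expansion c K.
have eL : e \in L2 by exact: expansion_L2.
have weL : (w \- e) \in L2 by exact: L2_sub.
have we : '<|w, e|> = \sum_(0 <= k < K) '<|w, phi k|> ^+ 2.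
  rewrite L2innerC /e L2inner_expansion//; apply: eq_bigr => k _.
  by rewrite L2innerC expr2.
have ee : '<|e, e|> = \sum_(0 <= k < K) '<|w, phi k|> ^+ 2.
  rewrite {1}/e L2inner_expansion// big_nat [RHS]big_nat; apply: eq_bigr => k /andP[_ kK].
  by rewrite L2innerC L2inner_expansion_phi kK expr2.
rewrite !sqr_L2norm L2inner_subl// L2innerC L2inner_subl// [X in _ - X]L2innerC.
by rewrite L2inner_subl// [X in _ - (X - _)]we ee [X in _ - X - _]L2innerC we; ring.
Qed.

Lemma bessel w K : w \in L2 -> \sum_(0 <= k < K) '<|w, phi k|> ^+ 2 <= norm w ^+ 2.
Proof. by move=> wL; rewrite -subr_ge0 -sqr_L2norm_sub_expansion// sqr_ge0. Qed.

Lemma sqr_L2inner_le w k : w \in L2 -> '<|w, phi k|> ^+ 2 <= norm w ^+ 2.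
Proof.
move=> wL; apply: le_trans (bessel k.+1 wL).
by rewrite big_nat_recr//= lerDr sumr_ge0// => j _; exact: sqr_ge0.
Qed.

(** Once [K > k], the remainder of the expansion has [k]-th coefficient ['<|w, phi k|> - c k],
    bounded by the norm of the remainder, which tends to 0. *)
Lemma L2_sum_coef c w k : L2_sum Omega (fun k y => c k * phi k y) w ->
  '<|w, phi k|> = c k.
Proof.
move=> [wL w0]; apply/eqP; rewrite -subr_eq0 -normr_eq0; apply/eqP.
apply: le_anti; rewrite normr_ge0 andbT.
apply: (cvgr_to_ge w0); near=> K.
have kK : (k < K)%N by near: K; exact: nbhs_infty_gt.
have eL := expansion_L2 c K; have weL := L2_sub wL eL.
have := sqr_L2inner_le k weL.
rewrite L2inner_subl// L2inner_expansion_phi kK -[X in X <= _]real_normK ?num_real//.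
by rewrite ler_sqr ?nnegrE ?L2norm_ge0.
Unshelve. all: by end_near. Qed.

Lemma sqr_L2norm_le w M : L2_sum Omega (fun k y => '<|w, phi k|> * phi k y) w ->
  (forall K, \sum_(0 <= k < K) '<|w, phi k|> ^+ 2 <= M) -> norm w ^+ 2 <= M.
Proof.
move=> [wL w0] HM.
have w20 : norm (w \- expansion (fun k => '<|w, phi k|>) K) ^+ 2 @[K --> \oo] --> (0 : R).
  by rewrite -[X in _ --> X](mulr0 0); apply: cvgM; exact: w0.
rewrite -subr_le0; apply: (cvgr_to_ge w20); near=> K.
by rewrite sqr_L2norm_sub_expansion// lerD2l lerN2.
Unshelve. all: by end_near. Qed.

End orthonormal.

Lemma eigenbasis_L2 lambda phi L k : eigenbasis Omega lambda phi L -> phi k \in L2.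
Proof. by move=> [_ /(_ k)[[[]]]]. Qed.

Lemma eigenbasis_lambda_gt0 lambda phi L k : eigenbasis Omega lambda phi L -> 0 < lambda k.
Proof. by move=> [[l0 ndl _] _ _ _]; rewrite (lt_le_trans l0)// ndl. Qed.

Lemma eigenbasis_inner lambda phi L k w : symmetric_uniformly_elliptic Omega L ->
  eigenbasis Omega lambda phi L -> w \in L2 ->
  '<|L (phi k), w|> = - (lambda k * '<|phi k, w|>).
Proof.
move=> [LL _ _] eb wL; have pL := eigenbasis_L2 k eb.
have [_ /(_ k)[pH pE] _ _] := eb.
have lpL : (fun x => - lambda k * phi k x + 0) \in L2 by apply: L2_lincomb => //; exact: L2_0.
rewrite (ae_L2inner (LL _ pH) lpL wL).
  by rewrite L2inner_lincombl ?L2_0// L2inner0l addr0 mulNr.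
by apply: filterS pE => x E; rewrite addr0 mulNr -E opprK.
Qed.

(* An eigenfunction of one basis has a nonzero coefficient in the other, and the
   two eigenvalues agree by symmetry.  This allows the stability constant to
   depend on the first eigenvalue although it is chosen before the basis. *)
Lemma eigenbasis_lambda0_le lambda phi lambda' phi' L :
  symmetric_uniformly_elliptic Omega L ->
  eigenbasis Omega lambda phi L -> eigenbasis Omega lambda' phi' L ->
  lambda' 0%N <= lambda 0%N.
Proof.
move=> ellL eb eb'; have pL := eigenbasis_L2 0 eb.
have pL' k := eigenbasis_L2 k eb'.
have [_ H on _] := eb; have [[_ ndl' _] H' on' full'] := eb'.
have [k pk] : exists k, '<|phi 0%N, phi' k|> != 0.
  apply: contrapT => /forallNP z.
  have : norm (phi 0%N) ^+ 2 <= 0.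
    apply: (sqr_L2norm_le pL' on' (full' _ pL)) => K.
    by rewrite big1// => k _; have /negP/negPn/eqP -> := z k; rewrite expr0n.
  by rewrite sqr_L2norm on eqxx ler10.
have [_ sym _] := ellL.
have := sym _ _ (H 0%N).1 (H' k).1.
rewrite (eigenbasis_inner _ ellL eb)// [RHS]L2innerC (eigenbasis_inner _ ellL eb')//.
rewrite [X in _ = - (_ * X)]L2innerC => /oppr_inj /(mulIf pk) ->.
exact: ndl'.
Qed.

End L2_expansions.

(** * Conditional stability *)

Section interpolation.
Context {R : realType}.
Implicit Types (lambda b : nat -> R).

Lemma interpolation_sum lambda b (p P0 q : R) K : 0 < p -> 0 <= P0 -> 0 <= q ->
  (forall k, 0 < lambda k) ->
  \sum_(0 <= k < K) lambda k `^ p * b k ^+ 2 <= P0 ^+ 2 ->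
  \sum_(0 <= k < K) (b k / lambda k) ^+ 2 <= q ^+ 2 ->
  \sum_(0 <= k < K) b k ^+ 2 <= 2 * (P0 `^ (2 / (p + 2)) * q `^ (p / (p + 2))) ^+ 2.
Proof.
move=> p0 P00 q0 l0 HP HQ.
have p2 : 0 < p + 2 by rewrite addr_gt0.
have p2n : p + 2 != 0 by rewrite gt_eqF.
(* The threshold below needs [P0] and [q] positive. If either is 0, a sum of squares with positive
   weights is 0 and every [b k] in it vanishes. *)
have vanish (w : nat -> R) : (forall k, 0 < w k) ->
    \sum_(0 <= k < K) w k * b k ^+ 2 <= 0 -> \sum_(0 <= k < K) b k ^+ 2 <= 0.
  move=> w0 H; have H0 : \sum_(0 <= k < K) w k * b k ^+ 2 == 0.
    by rewrite eq_le H sumr_ge0// => k _; rewrite mulr_ge0 ?sqr_ge0 ?(ltW (w0 k)).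
  move: H0; rewrite psumr_eq0 => [/allP H0|k _]; last first.
    by rewrite mulr_ge0 ?sqr_ge0 ?(ltW (w0 k)).
  rewrite big_seq big1// => k /H0; rewrite implyTb mulf_eq0 gt_eqF//=.
  by move=> /eqP.
have [P0E|Pn0] := eqVneq P0 0.
  apply: (@le_trans _ _ 0); last by rewrite mulr_ge0// sqr_ge0.
  apply: (vanish (fun k => lambda k `^ p)) => [k|]; first by rewrite powR_gt0.
  by rewrite (le_trans HP)// P0E expr0n.
have [qE|qn0] := eqVneq q 0.
  apply: (@le_trans _ _ 0); last by rewrite mulr_ge0// sqr_ge0.
  apply: (vanish (fun k => (lambda k ^+ 2)^-1)) => [k|]; first by rewrite invr_gt0 exprn_gt0.
  apply: (@le_trans _ _ (q ^+ 2)); last by rewrite qE expr0n.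
  apply: le_trans HQ; apply: ler_sum => k _.
  by rewrite expr_div_n mulrC.
have P0gt : 0 < P0 by rewrite lt_neqAle eq_sym Pn0.
have qgt : 0 < q by rewrite lt_neqAle eq_sym qn0.
(* The threshold balancing the bound [T ^ 2 * q ^ 2] on the modes with
   [lambda k <= T] against the bound [P0 ^ 2 / T ^ p] on the others. *)
pose T := (P0 / q) `^ (2 / (p + 2)).
have Pq : 0 < P0 / q by rewrite divr_gt0.
have T0 : 0 < T by rewrite powR_gt0.
have term k : b k ^+ 2 <= T ^+ 2 * (b k / lambda k) ^+ 2 + T `^ (- p) * (lambda k `^ p * b k ^+ 2).
  have lk := l0 k; have b2 : 0 <= b k ^+ 2 by exact: sqr_ge0.
  have [lT|/ltW Tl] := leP (lambda k) T.
    apply: (@le_trans _ _ (T ^+ 2 * (b k / lambda k) ^+ 2)).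
      rewrite expr_div_n mulrCA ler_peMr// ler_pdivlMr ?exprn_gt0// mul1r.
      by rewrite ler_sqr ?nnegrE ?(ltW lk) ?(ltW T0).
    by rewrite lerDl mulr_ge0 ?powR_ge0// mulr_ge0// powR_ge0.
  apply: (@le_trans _ _ (T `^ (- p) * (lambda k `^ p * b k ^+ 2))).
    rewrite mulrA ler_peMl// powRN ler_pdivlMl ?powR_gt0// mulr1.
    by rewrite ge0_ler_powR ?nnegrE ?(ltW lk) ?(ltW T0) ?(ltW p0).
  by rewrite lerDr mulr_ge0 ?sqr_ge0.
apply: (@le_trans _ _ (T ^+ 2 * q ^+ 2 + T `^ (- p) * P0 ^+ 2)).
  rewrite (le_trans (ler_sum _ (fun k _ => term k)))// big_split/= -!mulr_sumr.
  by apply: lerD; rewrite ler_wpM2l ?sqr_ge0 ?powR_ge0.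
have powRE (u r : R) : 0 < u -> u `^ r = expR (r * ln u) by move=> u0; rewrite /powR gt_eqF.
have sqrE (u : R) : 0 < u -> u ^+ 2 = expR (2 * ln u).
  by move=> u0; rewrite -(powR_mulrn _ (ltW u0)) powRE.
have lnT : ln T = 2 / (p + 2) * (ln P0 - ln q).
  by rewrite /T powRE// expRK ln_div.
(* At this threshold both terms equal the square on the right, whence the factor 2. *)
rewrite exprMn !sqrE ?powR_gt0// (powRE T)// lnT (powRE P0)// (powRE q)// !expRK -!expRD.
rewrite le_eqVlt; apply/orP; left; apply/eqP; rewrite [RHS]mulr_natl mulr2n.
by congr (expR _ + expR _); field.
Qed.

End interpolation.

Section fractional_norms.
Context {R : realType} {n : nat} {Omega : smooth_domain R n}.
Variables (lambda : nat -> R) (phi : nat -> 'rV[R]_n -> R).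

(** With [t = lambda k ^ r] and exponent [2 * s / r], [powR_le_expR_half] bounds the fractional
    weight by a multiple of the exponential one. *)
Lemma exponential_domain_fractional (r s : R) (g : 'rV[R]_n -> R) : 0 < r -> 0 <= s ->
  exponential_domain Omega lambda phi r g -> fractional_domain Omega lambda phi s g.
Proof.
move=> r0 s0 [gL Hg]; split => //.
have sr0 : 0 <= 2 * s / r by rewrite divr_ge0 ?mulr_ge0// ltW.
have [C C0 HC] := powR_le_expR_half sr0.
have key k : lambda k `^ (2 * s) <= C * expR (lambda k `^ r).
  rewrite (_ : 2 * s = r * (2 * s / r)); last by rewrite [RHS]mulrC divfK// gt_eqF.
  rewrite powRrM (le_trans (HC _ (powR_ge0 _ _)))// ler_pM2l// ler_expR.
  by rewrite ler_pdivrMr// ler_peMr ?powR_ge0// ler1n.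
apply: (@le_lt_trans _ _ (\sum_(0 <= k <oo) (C%:E *
    (expR (lambda k `^ r) * `|L2inner Omega g (phi k)| ^+ 2)%R%:E))%E).
  apply: lee_nneseries => [k _ _|k _].
    by rewrite lee_fin mulr_ge0 ?powR_ge0.
  by rewrite -EFinM lee_fin [leRHS]mulrA ler_wpM2r ?exprn_ge0.
rewrite nneseriesZl => [|k _]; last by rewrite lee_fin mulr_ge0 ?expR_ge0.
by rewrite lte_mul_pinfty ?lee_fin ?(ltW C0).
Qed.

Lemma sum_le_fractional_norm (s : R) (g : 'rV[R]_n -> R) K :
  fractional_domain Omega lambda phi s g ->
  \sum_(0 <= k < K) lambda k `^ (2 * s) * L2inner Omega g (phi k) ^+ 2 <=
  fractional_norm Omega lambda phi s g ^+ 2.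
Proof.
move=> [_ gfin]; rewrite /fractional_norm.
have F0 : (0 <= fractional_sum Omega lambda phi s g)%E.
  by apply: nneseries_ge0 => k _ _; rewrite lee_fin mulr_ge0 ?powR_ge0.
rewrite sqr_sqrtr ?fine_ge0// -lee_fin fineK ?ge0_fin_numE//.
have H := @nneseries_lim_ge R (fun k => (lambda k `^ (2 * s) *
  `|L2inner Omega g (phi k)| ^+ 2)%R%:E) xpredT 0 K.
apply: le_trans (H _); last by move=> k _ _; rewrite lee_fin mulr_ge0 ?powR_ge0.
rewrite sumEFin lee_fin le_eqVlt; apply/orP; left; apply/eqP.
by apply: eq_bigr => k _; rewrite real_normK ?num_real.
Qed.

End fractional_norms.

Section conditional_stability.
Context {R : realType} {N : nat} {Omega : smooth_domain R N}.
Variables (L : ('rV[R]_N -> R) -> 'rV[R]_N -> R) (alpha beta l : R).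
Hypothesis alpha_itv : 0 < alpha <= 1.
Hypothesis beta_ge0 : 0 <= beta.
Hypothesis l_gt0 : 0 < l.
Variables (lambda : nat -> R) (phi : nat -> 'rV[R]_N -> R).
Hypothesis eigen : eigenbasis Omega lambda phi L.
Local Notation coef f k := (L2inner Omega f (phi k)).
Local Notation norm := (L2norm Omega).

Let lambda0 k : 0 < lambda k. Proof. exact: eigenbasis_lambda_gt0 eigen. Qed.
Let phiL k : phi k \in L2 Omega. Proof. exact: eigenbasis_L2 eigen. Qed.
Let phi_on j k : L2inner Omega (phi j) (phi k) = (j == k)%:R.
Proof. by case: eigen => _ _ /(_ j k). Qed.

Let E k := mittag_leffler alpha beta (Num.sqrt (lambda k) * l `^ (alpha + beta)).

Lemma exact_solution_coef f g u k : exact_solution Omega lambda phi alpha beta f g u ->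
  u l \in L2 Omega /\
  coef (u l) k = coef f k * E k - coef g k / lambda k * (1 - E k).
Proof.
move=> /(_ l (ltW l_gt0))[u1 [u2 [Hu1 Hu2 ->]]].
have u1L := Hu1.1; have u2L := Hu2.1.
split; first exact: L2_sub.
rewrite L2inner_subl//.
have := L2_sum_coef phiL phi_on k Hu1 => ->.
have := L2_sum_coef phiL phi_on k Hu2 => ->.
rewrite !mulNr -/(mittag_leffler alpha beta _) -/(E k).
rewrite -eta2_kilbas_saigo//.
have s0 : Num.sqrt (lambda k) != 0 by rewrite gt_eqF// sqrtr_gt0.
congr (_ - _).
(* One root is explicit in the series for [g]; the other is the one inside the argument [z] of
   [eta2_kilbas_saigo]. *)
have -> : coef g k / lambda k = coef g k / Num.sqrt (lambda k) / Num.sqrt (lambda k).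
  by rewrite -mulrA -invfM -expr2 sqr_sqrtr// ltW.
move: (kilbas_saigo _ _ _ _) => K; move: (Num.sqrt _) s0 => v v0.
by field.
Qed.

Lemma coef_source_le f g u k (m : R) : exact_solution Omega lambda phi alpha beta f g u ->
  E k <= m -> m < 1 ->
  (coef g k / lambda k) ^+ 2 <= 2 / (1 - m) ^+ 2 * (coef (u l) k ^+ 2 + coef f k ^+ 2).
Proof.
move=> /(exact_solution_coef k)[_ hE] Em m1.
have E0 : 0 <= E k.
  by apply: mittag_leffler_ge0 => //; rewrite mulr_ge0 ?sqrtr_ge0 ?powR_ge0.
have m'0 : 0 < 1 - m by rewrite subr_gt0.
rewrite mulrAC ler_pdivlMr ?exprn_gt0//.
move: hE; move: (coef (u l) k) (coef f k) (coef g k / lambda k) => h a b hE.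
have bE : b * (1 - E k) = a * E k - h by rewrite hE; ring.
apply: (@le_trans _ _ ((b * (1 - E k)) ^+ 2)).
  rewrite exprMn ler_wpM2l ?sqr_ge0// ler_sqr ?nnegrE ?(ltW m'0)//; last by lra.
  by move: Em; lra.
rewrite bE; have : (a * E k) ^+ 2 <= a ^+ 2.
  by rewrite exprMn ler_piMr ?sqr_ge0// expr_le1//; lra.
(* Adding this square gives [(a * E k - h) ^ 2 <= 2 * ((a * E k) ^ 2 + h ^ 2)]. *)
have : 0 <= (a * E k + h) ^+ 2 by exact: sqr_ge0.
by nra.
Qed.

End conditional_stability.

Theorem theorem3 (R : realType) (N : nat) (N_ge1 : (1 <= N)%N)
    (Omega : smooth_domain R N) (L : ('rV[R]_N -> R) -> 'rV[R]_N -> R)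
    (L_elliptic : symmetric_uniformly_elliptic Omega L)
    (alpha beta l p : R) (alpha_itv : 0 < alpha <= 1) (beta_ge0 : 0 <= beta)
    (l_gt0 : 0 < l) (p_gt0 : 0 < p) :
  exists C : R, 0 < C /\
    forall (lambda : nat -> R) (phi : nat -> 'rV[R]_N -> R),
    eigenbasis Omega lambda phi L ->
    forall (f g h : 'rV[R]_N -> R) (u : R -> 'rV[R]_N -> R),
    f \in L2 Omega ->
    (exists2 r : R, 0 < r & exponential_domain Omega lambda phi r g) \/
      fractional_domain Omega lambda phi (p / 2) g ->
    exact_solution Omega lambda phi alpha beta f g u ->
    h = u l ->
    L2norm Omega g <=
      C * fractional_norm Omega lambda phi (p / 2) g `^ (2 / (p + 2)) *
      (L2norm Omega h + L2norm Omega f) `^ (p / (p + 2)).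

Proof.
(* [C] precedes the eigenbasis, so it is computed from one reference basis; if none exists, any
   positive [C] will do. *)
case: (pselect (exists lp : (nat -> R) * (nat -> 'rV[R]_N -> R),
    eigenbasis Omega lp.1 lp.2 L)) => [[[lambda' phi'] /= eigen']|none]; last first.
  exists 1; split=> // lambda phi eigen; exfalso; apply: none.
  by exists (lambda, phi).
have X0 : 0 < l `^ (alpha + beta) by rewrite powR_gt0.
pose m := mittag_leffler alpha beta (Num.sqrt (lambda' 0%N) * l `^ (alpha + beta)).
have m1 : m < 1.
  apply: mittag_leffler_lt1 => //.
  by rewrite mulr_gt0// sqrtr_gt0 (eigenbasis_lambda_gt0 _ eigen').
pose D := Num.sqrt (2 / (1 - m) ^+ 2).
have m'0 : 0 < 1 - m by rewrite subr_gt0.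
have D2 : 0 < 2 / (1 - m) ^+ 2 by rewrite divr_gt0// exprn_gt0.
have D0 : 0 < D by rewrite sqrtr_gt0.
(* [sqrt 2] is the root of the factor in [interpolation_sum], and the power of [D] comes from
   applying that lemma with [q = D * M]. *)
exists (Num.sqrt 2 * D `^ (p / (p + 2))); split.
  by rewrite mulr_gt0 ?sqrtr_gt0// powR_gt0.
move=> lambda phi eigen f g h u fL gdom sol ->.
have lambda0 k : 0 < lambda k by exact: eigenbasis_lambda_gt0 eigen.
have phiL k : phi k \in L2 Omega by exact: eigenbasis_L2 eigen.
have [[_ ndl _] _ on full] := eigen.
have {}gdom : fractional_domain Omega lambda phi (p / 2) g.
  case: gdom => // -[r r0]; apply: exponential_domain_fractional => //.
  by rewrite divr_ge0// ltW.
have gL := gdom.1.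
have [uL _] := exact_solution_coef alpha_itv beta_ge0 l_gt0 eigen 0 sol.
have Em k : mittag_leffler alpha beta (Num.sqrt (lambda k) * l `^ (alpha + beta)) <= m.
  apply: mittag_leffler_le => //; apply/andP; split.
    by rewrite mulr_ge0 ?sqrtr_ge0// ltW.
  rewrite ler_wpM2r ?(ltW X0)// ler_wsqrtr// (le_trans _ (ndl _ _ (leq0n k)))//.
  exact: eigenbasis_lambda0_le eigen eigen'.
set P0 := fractional_norm _ _ _ _ _.
set M := L2norm Omega (u l) + L2norm Omega f.
have M0 : 0 <= M by rewrite addr_ge0// L2norm_ge0.
have P00 : 0 <= P0 by exact: sqrtr_ge0.
have HP K : \sum_(0 <= k < K) lambda k `^ p * L2inner Omega g (phi k) ^+ 2 <= P0 ^+ 2.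
  have := sum_le_fractional_norm K gdom.
  by rewrite (_ : 2 * (p / 2) = p)//; field.
have HQ K : \sum_(0 <= k < K) (L2inner Omega g (phi k) / lambda k) ^+ 2 <= (D * M) ^+ 2.
  rewrite (le_trans (ler_sum _ (fun k _ =>
    coef_source_le alpha_itv beta_ge0 l_gt0 eigen sol (Em k) m1)))//.
  rewrite -mulr_sumr big_split/= exprMn sqr_sqrtr ?(ltW D2)// ler_pM2l//.
  rewrite (le_trans (lerD (bessel phiL on K uL) (bessel phiL on K fL)))//.
  by rewrite /M sqrrD [leRHS]addrAC lerDl mulrn_wge0// mulr_ge0// L2norm_ge0.
have DM0 : 0 <= D * M by rewrite mulr_ge0// ltW.
have main := sqr_L2norm_le phiL on (full g gL)
  (fun K => interpolation_sum p_gt0 P00 DM0 lambda0 (HP K) (HQ K)).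
rewrite -ler_sqr ?nnegrE ?L2norm_ge0//; last first.
  by rewrite !mulr_ge0 ?powR_ge0 ?sqrtr_ge0.
apply: le_trans main _; rewrite (powRM _ (ltW D0) M0).
rewrite [leRHS](_ : _ = Num.sqrt 2 ^+ 2 * (P0 `^ (2 / (p + 2)) *
  (D `^ (p / (p + 2)) * M `^ (p / (p + 2)))) ^+ 2); last by ring.
by rewrite sqr_sqrtr.
Qed.
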